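(* Suppose that (A1) $\min\{d_1,\dots,d_{L-1}\}\ge\min\{d_0,d_L\}$, and (A2) with $\lambda:=\lambda_1\cdots\lambda_L$: if $L=2$, then $\lambda\ne y_i^2$ for all $i\in[r_Y]$; if $L\ge3$, then $$\lambda\ne y_i^{2(L-1)}\left(\Big(\tfrac{L-2}{L}\Big)^{\frac{L}{2(L-1)}}+\Big(\tfrac{L}{L-2}\Big)^{\frac{L-2}{2(L-1)}}\right)^{-2(L-1)}\quad\forall i\in[r_Y].$$ Then there exist constants $\epsilon_1,\kappa_1>0$ such that for all $\bm W$ with $\mathrm{dist}(\bm W,\mathcal W_F)\le\epsilon_1$, $$\mathrm{dist}(\bm W,\mathcal W_F)\le\kappa_1\|\nabla F(\bm W)\|_F.$$
   Context: Let $L\ge2$, $d_0,\dots,d_L$ positive integers, $\bm Y\in\mathbb R^{d_L\times d_0}$ with singular values $y_1\ge\dots\ge y_{d_{\min}}\ge0$, $d_{\min}=\min\{d_0,d_L\}$, and $r_Y=\mathrm{rank}(\bm Y)$. Let $\lambda_1,\dots,\lambda_L>0$. For $\bm W=(\bm W_1,\dots,\bm W_L)$ with $\bm W_l\in\mathbb R^{d_l\times d_{l-1}}$, $F(\bm W)=\|\bm W_L\cdots\bm W_1-\bm Y\|_F^2+\sum_{l}\lambda_l\|\bm W_l\|_F^2$, $\mathcal W_F=\{\bm W:\nabla F(\bm W)=\bm0\}$, and $\mathrm{dist}(\bm W,\mathcal S)=\inf_{\bm V\in\mathcal S}\big(\sum_l\|\bm W_l-\bm V_l\|_F^2\big)^{1/2}$;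 $\|\nabla F(\bm W)\|_F=(\sum_l\|\nabla_{\bm W_l}F(\bm W)\|_F^2)^{1/2}$. *)

(* Defs.v *)
From HB Require Import structures.
From mathcomp Require Import all_boot all_order all_algebra.
From mathcomp Require Import all_classical all_reals all_analysis.
Set Implicit Arguments. Unset Strict Implicit. Unset Printing Implicit Defensive.
Import Order.TTheory GRing.Theory Num.Theory.
Local Open Scope ring_scope.

Section DeepLinear.
Variable R : realType.
(* Layer widths: d 0, ..., d L.  The weights are indexed by k = 0..L-1,
   where W k stands for the paper's W_{k+1} : R^{d_{k+1} x d_k}.
   Components with k >= L are irrelevant (never used below). *)
Variable d : nat -> nat.

Definition weights := forall k : nat, 'M[R]_(d k.+1, d k).

Definition frob2 m n (A : 'M[R]_(m, n)) : R :=
  \sum_(i < m) \sum_(j < n) A i j ^+ 2.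

Fixpoint prodW (W : weights) (k : nat) : 'M[R]_(d k, d 0) :=
  match k with
  | 0 => 1%:M
  | k'.+1 => W k' *m prodW W k'
  end.

(* F(W) = ||W_L...W_1 - Y||_F^2 + sum_l lambda_l ||W_l||_F^2 ;
   lam k stands for lambda_{k+1}. *)
Definition Fobj (L : nat) (lam : nat -> R) (Y : 'M[R]_(d L, d 0))
  (W : weights) : R :=
  frob2 (prodW W L - Y) + \sum_(k < L) lam k * frob2 (W k).

Definition Edir (l i j : nat) : weights :=
  fun k => \matrix_(a < d k.+1, b < d k)
             ((k == l) && (a == i :> nat) && (b == j :> nat))%:R.

Definition gradF (L : nat) (lam : nat -> R) (Y : 'M[R]_(d L, d 0))
  (W : weights) (l i j : nat) : R :=
  derive1 (fun t : R => Fobj lam Y (fun k => W k + t *: Edir l i j k)) 0.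

Definition gradnorm2 (L : nat) (lam : nat -> R) (Y : 'M[R]_(d L, d 0))
  (W : weights) : R :=
  \sum_(l < L) \sum_(i < d l.+1) \sum_(j < d l) gradF lam Y W l i j ^+ 2.

Definition critset (L : nat) (lam : nat -> R) (Y : 'M[R]_(d L, d 0)) :
  set weights :=
  [set W | forall (l : 'I_L) (i : 'I_(d l.+1)) (j : 'I_(d l)),
             gradF lam Y W l i j = 0].

Definition wdist (L : nat) (W V : weights) : R :=
  Num.sqrt (\sum_(l < L) frob2 (W l - V l)).

Definition setdist (L : nat) (W : weights) (S : set weights) : R :=
  inf [set r | exists2 V, S V & r = wdist L W V].

End DeepLinear.

(* s is a singular value of Y : there are nonzero u, v with
   Y v = s u and Y^T u = s v, s >= 0.  The positive singular values of Y are
   exactly y_1, ..., y_{r_Y}. *)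
Definition singular_value (R : realType) m n (Y : 'M[R]_(m, n)) (s : R) : Prop :=
  0 <= s /\ exists (u : 'cV[R]_m) (v : 'cV[R]_n),
    [/\ u != 0, v != 0, Y *m v = s *: u & Y^T *m u = s *: v].

(* Main.v *)
Require Import Defs.
From HB Require Import structures.
From mathcomp Require Import all_boot all_order all_algebra.
From mathcomp Require Import all_classical all_reals all_analysis.
From mathcomp Require Import complex.
From mathcomp Require Import ring lra zify.
Set Implicit Arguments. Unset Strict Implicit. Unset Printing Implicit Defensive.
Import Order.TTheory GRing.Theory Num.Theory.
Local Open Scope ring_scope.

(* Idea. Otherwise there are points W_k approaching the critical set whose
   gradients are negligible with respect to their distance to it. Take V_k
   critical and almost nearest to W_k. By compactness the directions
   (W_k - V_k) / |W_k - V_k| converge (along an ultrafilter) to a unit vector u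
   in the kernel of the Hessian of F at v = lim V_k. The point is that every
   kernel vector is an infinitesimal symmetry: u_l = A_{l+1} v_l - v_l A_l with
   A_l skew-symmetric and A_L Y = Y A_0. The Cayley transforms of the A_l then
   move V_k inside the critical set in a direction close to u, which brings it
   closer to W_k than almost nearest allows.

   For the description of the kernel, rescale all lambda_l to the same value
   mu. At a critical point the W_l intertwine the Gram matrices
   M_l = W_l^T W_l = W_{l-1} W_{l-1}^T, hence their spectral projections, and
   the Hessian is block diagonal for them. The blocks between different
   eigenvalues are solved by a Sylvester equation, without any hypothesis. In
   the block of an eigenvalue s > 0 the W_l are isometries up to a scalar and
   the kernel equation forces the gauge form unless
   L s^(L-1) = (L-2) mu; this equality, or for L = 2 a degenerate block s = 0,
   makes a singular value of Y violate (A2). *)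

(** * Spectral decomposition *)

Section Spectral.
Local Open Scope sesquilinear_scope.

(** [N s] is the orthogonal eigenprojection, zero when [s] is not an eigenvalue. Summing over any
    duplicate-free list that contains the spectrum lets several matrices share one index list. *)
Lemma hermitian_spectral (C : numClosedFieldType) n (A : 'M[C]_n) :
  A \is hermsymmx ->
  exists (D : 'rV[C]_n) (N : C -> 'M[C]_n),
    [/\ forall j, D 0 j \is Num.real, forall s, (N s)^t* = N s,
        forall s, A *m N s = s *: N s &
        forall T : seq C, uniq T -> (forall j, D 0 j \in T) ->
          \sum_(s <- T) N s = 1%:M].
Proof.
move=> Aherm; have /orthomx_spectralP := hermitian_normalmx Aherm.
have /mxOverP/(_ 0) Dreal := hermitian_spectral_diag_real Aherm.
have := spectral_unitarymx A.
move: (spectralmx A) (spectral_diag A) Dreal => P D Dreal Pu.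
rewrite (invmx_unitary Pu) => AE.
have PP : P *m P^t* = 1%:M by apply/unitarymxP.
have PP' := mulmx1C PP.
pose dg s : 'rV[C]_n := \row_j (D 0 j == s)%:R.
exists D, (fun s => P^t* *m diag_mx (dg s) *m P); split => //.
- move=> s; rewrite !trmx_mul !map_mxM trmxCK mulmxA tr_diag_mx map_diag_mx.
  suff -> : map_mx Num.conj (dg s) = dg s by [].
  apply/matrixP => i j; rewrite !mxE.
  by case: (_ == _); rewrite ?conjC0 ?conjC1.
- move=> s; rewrite AE !mulmxA -[_ *m P *m _]mulmxA PP mulmx1.
  rewrite -[_ *m diag_mx D *m _]mulmxA mulmx_diag scalemxAl scalemxAr.
  suff -> : diag_mx (\row_j (D 0 j * dg s 0 j)) = s *: diag_mx (dg s).
    by [].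
  apply/matrixP => i j; rewrite !mxE.
  case: (i == j); rewrite ?mulr0n ?mulr0 // !mulr1n.
  by case: eqP => [->|_]; rewrite ?mulr1 ?mulr0.
- move=> T uT sT; rewrite -mulmx_suml -mulmx_sumr.
  suff -> : \sum_(s <- T) diag_mx (dg s) = 1%:M by rewrite mulmx1.
  apply/matrixP => i j; rewrite summxE !mxE.
  have [<-|ij] := eqVneq i j; last first.
    by rewrite big1 // => s _; rewrite !mxE (negPf ij).
  rewrite (bigD1_seq _ (sT i) uT) /= !mxE eqxx mulr1n eqxx big1 ?addr0 //.
  by move=> s sn; rewrite !mxE eqxx mulr1n eq_sym (negPf sn).
Qed.

(* The eigenprojections of a real matrix are the real parts of those of its
   complexification, which the library diagonalizes. *)
Lemma symmetric_spectral (R : realType) n (M : 'M[R]_n) : M^T = M ->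
  exists (S : seq R) (p : R -> 'M[R]_n),
    [/\ forall s, (p s)^T = p s, forall s, M *m p s = s *: p s &
        forall T : seq R, uniq T -> {subset S <= T} ->
          \sum_(s <- T) p s = 1%:M].
Proof.
move=> MT; pose A : 'M[R[i]]_n := map_mx (real_complex R) M.
have Aherm : A \is hermsymmx.
  apply/is_hermitianmxP; rewrite expr0 scale1r; apply/matrixP => i j.
  by rewrite !mxE -[in LHS]MT mxE; apply/esym/conjc_real.
have [D [N [Dreal NT AN NS]]] := hermitian_spectral Aherm.
exists [seq complex.Re (D 0 j) | j <- enum 'I_n].
exists (fun s => map_mx (@complex.Re R) (N (s%:C)%C)); split.
- move=> s; rewrite -[in LHS]NT; apply/matrixP => i j; rewrite !mxE.
  by case: (N _ i j).
- move=> s; apply/matrixP => i k; have /matrixP/(_ i k) := AN (s%:C)%C.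
  rewrite mxE [X in _ = X]mxE => /(congr1 (@complex.Re R)) e.
  have sE : complex.Re ((s%:C)%C * N (s%:C)%C i k)
      = s * complex.Re (N (s%:C)%C i k).
    by case: (N _ i k) => a b /=; rewrite mul0r subr0.
  rewrite [RHS]mxE [X in _ = s * X]mxE -sE -e raddf_sum mxE.
  apply: eq_bigr => j _; rewrite !mxE.
  by case: (N _ j k) => a b /=; rewrite mul0r subr0.
- move=> T uT sT.
  have uT' : uniq [seq (s%:C)%C | s <- T].
    by rewrite map_inj_uniq // => x y /complexI.
  have DT j : D 0 j \in [seq (s%:C)%C | s <- T].
    rewrite -(RRe_real (Dreal j)); apply/map_f/sT/mapP.
    by exists j; rewrite ?mem_enum.
  have /(congr1 (map_mx (@complex.Re R))) := NS _ uT' DT.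
  rewrite big_map map_mx_sum => ->.
  by apply/matrixP => i j; rewrite !mxE; case: (i == j).
Qed.

End Spectral.

(** * Partial products of the layers and their differentials *)

Lemma trmxD (R : pzRingType) m n (A B : 'M[R]_(m, n)) :
  (A + B)^T = A^T + B^T.
Proof. by apply/matrixP => i j; rewrite !mxE. Qed.

Lemma trmxB (R : pzRingType) m n (A B : 'M[R]_(m, n)) :
  (A - B)^T = A^T - B^T.
Proof. by apply/matrixP => i j; rewrite !mxE. Qed.

Lemma trmxZ (R : pzRingType) m n a (A : 'M[R]_(m, n)) :
  (a *: A)^T = a *: A^T.
Proof. by apply/matrixP => i j; rewrite !mxE. Qed.

Section Segments.
Variables (R : realType) (d : nat -> nat).
Implicit Types W U V : weights R d.

(* [seg W i j] is the partial product W_{j-1} ... W_i (the paper's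
   W_j ... W_{i+1}); [pid_mx] provides an identity matrix without casts.
   It is locked since unification would unfold [seg W i j.+1]. *)
Fixpoint seg_rec W (i j : nat) : 'M[R]_(d j, d i) :=
  match j with
  | 0 => pid_mx (d i)
  | j'.+1 => if (i <= j')%N then W j' *m seg_rec W i j' else pid_mx (d i)
  end.
Fact seg_key : unit. Proof. exact: tt. Qed.
Definition seg := locked_with seg_key seg_rec.

Lemma segii W i : seg W i i = 1%:M.
Proof. by rewrite /seg unlock; case: i => [|i] /=; rewrite ?ltnn pid_mx_1. Qed.

Lemma segS W i j : (i <= j)%N -> seg W i j.+1 = W j *m seg W i j.
Proof. by rewrite /seg unlock /= => ->. Qed.

Lemma seg1 W i : seg W i i.+1 = W i.
Proof. by rewrite segS // segii mulmx1. Qed.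

Lemma seg0 W j : seg W 0 j = prodW W j.
Proof. by elim: j => [|j IH]; [rewrite segii | rewrite segS // IH]. Qed.

Lemma segM W i k j : (i <= k <= j)%N -> seg W k j *m seg W i k = seg W i j.
Proof.
move=> /andP[ik]; elim: j => [|j IH].
  by rewrite leqn0 => /eqP k0; subst k; rewrite segii mul1mx.
rewrite leq_eqVlt => /orP[/eqP <-|]; first by rewrite segii mul1mx.
rewrite ltnS => kj.
by rewrite !segS ?(leq_trans ik kj) // -mulmxA IH.
Qed.

Lemma segSl W i j : (i < j)%N -> seg W i j = seg W i.+1 j *m W i.
Proof. by move=> ij; rewrite -(segM W (k := i.+1)) ?leqnSn // seg1. Qed.

(** Derivative of [seg W i j] in [W] along [U], by the Leibniz rule. *)
Fixpoint dseg_rec W U (i j : nat) : 'M[R]_(d j, d i) :=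
  match j with
  | 0 => 0
  | j'.+1 => if (i <= j')%N then U j' *m seg W i j' + W j' *m dseg_rec W U i j'
             else 0
  end.
Fact dseg_key : unit. Proof. exact: tt. Qed.
Definition dseg := locked_with dseg_key dseg_rec.

Lemma dsegS W U i j : (i <= j)%N ->
  dseg W U i j.+1 = U j *m seg W i j + W j *m dseg W U i j.
Proof. by rewrite /dseg unlock /= => ->. Qed.

Lemma dsegii W U i : dseg W U i i = 0.
Proof. by rewrite /dseg unlock; case: i => [|i] //=; rewrite ltnn. Qed.

Lemma dsegE W U i j : (i <= j)%N ->
  dseg W U i j = \sum_(i <= k < j) seg W k.+1 j *m U k *m seg W i k.
Proof.
elim: j => [|j IH]; first by rewrite leqn0 => /eqP ->; rewrite dsegii big_geq.
rewrite leq_eqVlt => /orP[/eqP ->|]; first by rewrite dsegii big_geq.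
rewrite ltnS => ij; rewrite dsegS // big_nat_recr //= segii mul1mx addrC.
congr (_ + _); rewrite IH // mulmx_sumr; apply: eq_big_nat => k /andP[_ kj].
by rewrite segS // !mulmxA.
Qed.

Lemma dsegSl W U i j : (i < j)%N ->
  dseg W U i j = dseg W U i.+1 j *m W i + seg W i.+1 j *m U i.
Proof.
move=> ij; rewrite !dsegE ?(ltnW ij) // big_ltn // segii mulmx1 addrC.
congr (_ + _); rewrite mulmx_suml; apply: eq_big_nat => k /andP[ik _].
by rewrite -[RHS]mulmxA -segSl.
Qed.

Lemma seg_ext W W' i j : (i <= j)%N ->
  (forall k, (i <= k < j)%N -> W k = W' k) -> seg W i j = seg W' i j.
Proof.
elim: j => [|j IH]; first by rewrite leqn0 => /eqP -> _; rewrite !segii.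
rewrite leq_eqVlt => /orP[/eqP -> _|]; first by rewrite !segii.
rewrite ltnS => ij e; rewrite !segS // e ?ij ?leqnn // IH // => k /andP[ik kj].
by rewrite e // ik ltnW.
Qed.

Lemma dseg_ext W U U' i j : (forall k, (k < j)%N -> U k = U' k) ->
  dseg W U i j = dseg W U' i j.
Proof.
rewrite /dseg unlock; elim: j => [//|j IH] e /=; rewrite e // IH // => k kj.
exact/e/ltnW.
Qed.

Variables (L : nat) (lam : nat -> R) (Y : 'M[R]_(d L, d 0)).

(** Half of the gradient of the objective in layer [l]. The next definition is its derivative along
    [U], by the product rule on the three factors. *)
Definition gradmx W l : 'M[R]_(d l.+1, d l) :=
  (seg W l.+1 L)^T *m (seg W 0 L - Y) *m (seg W 0 l)^T + lam l *: W l.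

Definition hessmx W U l : 'M[R]_(d l.+1, d l) :=
  (dseg W U l.+1 L)^T *m (seg W 0 L - Y) *m (seg W 0 l)^T
  + (seg W l.+1 L)^T *m dseg W U 0 L *m (seg W 0 l)^T
  + (seg W l.+1 L)^T *m (seg W 0 L - Y) *m (dseg W U 0 l)^T + lam l *: U l.

(** Infinitesimal action of layerwise changes of basis; for skew-symmetric [A] it is tangent to the
    orthogonal action. *)
Definition rotate (A : forall l, 'M[R]_(d l)) W : weights R d :=
  fun k => A k.+1 *m W k - W k *m A k.

(** The Leibniz sum telescopes: each inner [A k] occurs once with either sign, and only the two ends
    survive. *)
Lemma dseg_rotate A W i j : (i <= j)%N ->
  dseg W (rotate A W) i j = A j *m seg W i j - seg W i j *m A i.
Proof.
elim: j => [|j IH].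
  by rewrite leqn0 => /eqP ->; rewrite dsegii segii mulmx1 mul1mx subrr.
rewrite leq_eqVlt => /orP[/eqP ->|].
  by rewrite dsegii segii mulmx1 mul1mx subrr.
rewrite ltnS => ij; rewrite dsegS // IH // segS // /rotate.
by rewrite mulmxBl mulmxBr !mulmxA subrKA.
Qed.

(* Differentiating the equivariance of the gradient under
   (W, Y) |-> (Q_{l+1} W_l Q_l^T, Q_L Y Q_0^T) along skew-symmetric [A]. *)
Lemma hessmx_rotate A W l :
  (forall k, (k <= L)%N -> (A k)^T = - A k) -> (l < L)%N ->
  hessmx W (rotate A W) l =
  A l.+1 *m gradmx W l - gradmx W l *m A l
  + (seg W l.+1 L)^T *m (A L *m Y - Y *m A 0) *m (seg W 0 l)^T.
Proof.
move=> AT lL; rewrite /hessmx !dseg_rotate // ?(ltnW lL) //.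
rewrite !trmxB !trmx_mul !AT ?(ltnW lL) // /gradmx.
set P := seg W 0 L; set a := (seg W l.+1 L)^T; set b := (seg W 0 l)^T.
rewrite !(mulmxDl, mulmxDr, mulmxBl, mulmxBr, mulmxN, mulNmx, opprK, opprD,
  opprB, mulmxA) -!scalemxAl -!scalemxAr.
move: (a *m A L *m P *m b) (a *m A L *m Y *m b) (A l.+1 *m a *m P *m b)
  (A l.+1 *m a *m Y *m b) (a *m P *m A 0 *m b) (a *m Y *m A 0 *m b)
  (a *m P *m b *m A l) (a *m Y *m b *m A l) => x1 x2 x3 x4 x5 x6 x7 x8.
rewrite /rotate ?scalerBr.
move: (lam l *: _) (lam l *: _) => x9 x10.
by apply/matrixP => i j; rewrite !mxE; ring.
Qed.

End Segments.

(** * Critical points when all regularization weights are equal *)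

Lemma mulTmx_eq0 (R : realType) m n (A : 'M[R]_(m, n)) : A^T *m A = 0 -> A = 0.
Proof.
move=> /matrixP A0; apply/matrixP => i j; rewrite mxE.
have := A0 j j; rewrite !mxE => /eqP; rewrite psumr_eq0 => [/allP|k _].
  by move=> /(_ i (mem_index_enum _)); rewrite mxE mulf_eq0 orbb => /eqP.
by rewrite mxE -expr2 sqr_ge0.
Qed.

Lemma hessmx_ext (R : realType) d (L : nat) (lam : nat -> R)
    (Y : 'M[R]_(d L, d 0)) (W U U' : weights R d) l :
  (forall k, (k < L)%N -> U k = U' k) -> (l < L)%N ->
  hessmx lam Y W U l = hessmx lam Y W U' l.
Proof.
move=> e lL; rewrite /hessmx !(dseg_ext W (U := U) (U' := U')) ?e // => k kl.
by apply: e; apply: ltn_trans lL.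
Qed.

(** Insert the two resolutions of the identity: since only diagonal blocks survive, both sides equal
    [q s *m X *m p s]. *)
Lemma intertwine_projections (R : realType) (T : seq R) m n
    (p : R -> 'M[R]_n) (q : R -> 'M[R]_m) (X : 'M[R]_(m, n)) :
  uniq T -> \sum_(s <- T) p s = 1%:M -> \sum_(s <- T) q s = 1%:M ->
  (forall s t, s \in T -> t \in T -> s != t -> q t *m X *m p s = 0) ->
  forall s, s \in T -> X *m p s = q s *m X.
Proof.
move=> uT p1 q1 qXp s sT; transitivity (q s *m X *m p s).
  rewrite -[X in LHS]mul1mx -q1 !mulmx_suml (bigD1_seq s) //=.
  rewrite big1_seq ?addr0 //.
  by move=> t /andP[ts tT]; apply: qXp => //; rewrite eq_sym.
rewrite -[RHS]mulmx1 -p1 mulmx_sumr (bigD1_seq s) //= big1_seq ?addr0 //.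
by move=> t /andP[ts tT]; apply: qXp.
Qed.

(** The list is the union of the spectra of all the [M l]; a value outside the spectrum of [M l]
    contributes a zero projection there. *)
Lemma common_spectral (R : realType) (d : nat -> nat) (L : nat)
    (M : forall l, 'M[R]_(d l)) : (forall l, (l <= L)%N -> (M l)^T = M l) ->
  exists (T : seq R) (p : forall l, R -> 'M[R]_(d l)), uniq T /\
    forall l, (l <= L)%N ->
    [/\ forall s, (p l s)^T = p l s, forall s, M l *m p l s = s *: p l s &
        \sum_(s <- T) p l s = 1%:M].
Proof.
move=> MT.
have H l : exists Sp : seq R * (R -> 'M[R]_(d l)), (l <= L)%N ->
    [/\ forall s, (Sp.2 s)^T = Sp.2 s, forall s, M l *m Sp.2 s = s *: Sp.2 s &
        forall T : seq R, uniq T -> {subset Sp.1 <= T} ->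
          \sum_(s <- T) Sp.2 s = 1%:M].
  have [lL|_] := leqP l L; last by exists ([::], fun=> 0).
  by have [S [p Sp]] := symmetric_spectral (MT l lL); exists (S, p).
pose Sp l := projT1 (cid (H l)).
exists (undup (flatten [seq (Sp l).1 | l <- iota 0 L.+1])).
exists (fun l => (Sp l).2); split=> [|l lL]; first exact: undup_uniq.
have [pT Mp p1] := projT2 (cid (H l)) lL.
split=> //; apply: p1 => [|s sl]; first exact: undup_uniq.
rewrite mem_undup; apply/flattenP; exists (Sp l).1 => //.
by apply/mapP; exists l; rewrite ?mem_iota ?add0n.
Qed.

Section CriticalPoint.
Variables (R : realType) (d : nat -> nat) (n : nat).
Local Notation L := n.+2.
Variables (mu : R) (Y : 'M[R]_(d L, d 0)) (W : weights R d).
Hypothesis mu_gt0 : 0 < mu.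
Hypothesis critW : forall l, (l < L)%N -> gradmx (fun=> mu) Y W l = 0.

Local Notation E := (seg W 0 L - Y).
Local Notation hess := (hessmx (fun=> mu) Y W).

Let mu_neq0 : mu != 0. Proof. by rewrite gt_eqF. Qed.

Lemma crit_seg l : (l < L)%N ->
  (seg W l.+1 L)^T *m E *m (seg W 0 l)^T = - (mu *: W l).
Proof. by move/critW/eqP; rewrite addr_eq0 => /eqP. Qed.

(* The two Gram matrices W_l W_l^T and W_{l+1}^T W_{l+1} agree at a critical
   point; this formula gives their common value also for l = 0 and l = L. *)
Definition gram l : 'M[R]_(d l) :=
  - (mu^-1 *: ((seg W l L)^T *m E *m (seg W 0 l)^T)).

(** Multiply the critical equation of layer [l] on the right by [(W l)^T], which extends
    [(seg W 0 l)^T] by one layer. Multiplying on the left instead gives [gramE]; together they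
    express the balancedness of critical points. *)
Lemma gramS l : (l < L)%N -> gram l.+1 = W l *m (W l)^T.
Proof.
move=> lL; rewrite /gram (segS W (leq0n l)) trmx_mul mulmxA crit_seg //.
by rewrite mulNmx scalerN opprK -scalemxAl scalerA mulVf ?scale1r.
Qed.

Lemma gramE l : (l < L)%N -> gram l = (W l)^T *m W l.
Proof.
move=> lL; rewrite /gram segSl // trmx_mul -!mulmxA [_ *m (E *m _)]mulmxA.
by rewrite crit_seg // mulmxN scalerN opprK -scalemxAr scalerA mulVf ?scale1r.
Qed.

Lemma gramT l : (l <= L)%N -> (gram l)^T = gram l.
Proof.
rewrite leq_eqVlt => /orP[/eqP ->|lL].
  by rewrite gramS // trmx_mul trmxK.
by rewrite gramE // trmx_mul trmxK.
Qed.

Lemma mul_gram l : (l < L)%N -> W l *m gram l = gram l.+1 *m W l.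
Proof. by move=> lL; rewrite gramE // gramS // mulmxA. Qed.

Lemma seg_gram i j : (i <= j <= L)%N ->
  seg W i j *m gram i = gram j *m seg W i j.
Proof.
move=> /andP[ij]; elim: j ij => [|j IH].
  by rewrite leqn0 => /eqP -> _; rewrite segii mul1mx mulmx1.
rewrite leq_eqVlt => /orP[/eqP -> _|].
  by rewrite segii mul1mx mulmx1.
rewrite ltnS => ij jL; rewrite segS // -mulmxA IH // ?(ltnW jL) //.
by rewrite !mulmxA mul_gram.
Qed.

(** On the eigenspace for [s], each product of a layer with its transpose is a Gram matrix and acts
    as [s]; peeling off the [j - i] layers gives the power. *)
Lemma seg_segT i j m s (X : 'M[R]_(d j, m)) : (i <= j <= L)%N ->
  gram j *m X = s *: X ->
  seg W i j *m ((seg W i j)^T *m X) = s ^+ (j - i) *: X.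
Proof.
move=> /andP[ij]; elim: j ij X => [|j IH].
  rewrite leqn0 => /eqP -> X _; rewrite segii trmx1 !mul1mx.
  by rewrite expr0 scale1r.
rewrite leq_eqVlt => /orP[/eqP -> X _ _|].
  by rewrite segii trmx1 !mul1mx subnn expr0 scale1r.
rewrite ltnS => ij X jL gX; rewrite segS // trmx_mul.
rewrite -!mulmxA (IH ij _ (ltnW jL)); last first.
  by rewrite gramE // -!mulmxA [W j *m (_ *m _)]mulmxA -gramS // gX scalemxAr.
by rewrite -scalemxAr mulmxA -gramS // gX scalerA subSn // exprSr.
Qed.

Lemma segT_seg i j m s (X : 'M[R]_(d i, m)) : (i <= j <= L)%N ->
  gram i *m X = s *: X ->
  (seg W i j)^T *m (seg W i j *m X) = s ^+ (j - i) *: X.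
Proof.
move=> /andP[ij]; elim: j ij => [|j IH].
  rewrite leqn0 => /eqP i0 _; subst i; rewrite segii trmx1 !mul1mx.
  by rewrite expr0 scale1r.
rewrite leq_eqVlt => /orP[/eqP i0 _ _|].
  by subst i; rewrite segii trmx1 !mul1mx subnn expr0 scale1r.
rewrite ltnS => ij jL gX; rewrite segS // trmx_mul.
rewrite -!mulmxA [_ *m (W j *m _)]mulmxA -gramE // [gram j *m _]mulmxA.
rewrite -seg_gram ?ij ?(ltnW jL) // -[_ *m _ *m X]mulmxA gX -!scalemxAr.
by rewrite IH ?(ltnW jL) // scalerA subSn // exprS.
Qed.

Lemma prod_trE : (seg W 0 L)^T *m E = - (mu *: gram 0).
Proof.
rewrite /gram segii trmx1 mulmx1 scalerN opprK scalerA mulfV //.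
by rewrite scale1r.
Qed.

(** Apply the critical equation of the last layer to [seg W 0 n.+1 *m X]: the product of that
    segment with its transpose collapses to a power of [s]. The mirror statement uses the first
    layer. *)
Lemma E_eigen m s (X : 'M[R]_(d 0, m)) : gram 0 *m X = s *: X ->
  s ^+ n.+1 *: (E *m X) = - (mu *: (seg W 0 L *m X)).
Proof.
move=> gX; have := crit_seg (ltnSn n.+1); rewrite segii trmx1 mul1mx => e.
have {}e := congr1 (mulmx^~ (seg W 0 n.+1 *m X)) e; move: e => /=.
rewrite -[LHS]mulmxA (segT_seg _ gX) ?leqnSn // subn0 -scalemxAr => ->.
by rewrite mulNmx -scalemxAl mulmxA -segS.
Qed.

Lemma eigen_E m s (X : 'M[R]_(m, d L)) : X *m gram L = s *: X ->
  s ^+ n.+1 *: (X *m E) = - (mu *: (X *m seg W 0 L)).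
Proof.
move=> Xg; have gX : gram L *m X^T = s *: X^T.
  by rewrite -gramT // -trmx_mul Xg trmxZ.
have := crit_seg (ltn0Sn n.+1); rewrite segii trmx1 mulmx1 => e.
have /= {}e := congr1 (mulmx (X *m seg W 1 L)) e.
move: e; rewrite mulmxA.
have -> : X *m seg W 1 L *m (seg W 1 L)^T = s ^+ n.+1 *: X.
  have /(congr1 trmx) := seg_segT (i := 1) (j := L) (ltnSn _) gX.
  by rewrite !trmx_mul !trmxK trmxZ trmxK subn1.
by rewrite -scalemxAl => ->; rewrite mulmxN -scalemxAr -mulmxA -segSl.
Qed.

(** * Kernel directions supported on one eigenspace of the Gram matrices *)

Section Block.
Variables (s : R) (V : weights R d).
Hypothesis gramV : forall l, (l < L)%N -> gram l.+1 *m V l = s *: V l.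
Hypothesis Vgram : forall l, (l < L)%N -> V l *m gram l = s *: V l.
Hypothesis hessV : forall l, (l < L)%N -> hess V l = 0.

Let gramVT l : (l < L)%N -> gram l *m (V l)^T = s *: (V l)^T.
Proof.
by move=> lL; rewrite -{1}[gram l]gramT 1?ltnW // -trmx_mul Vgram // trmxZ.
Qed.

Section PositiveEigenvalue.
Hypothesis s_gt0 : 0 < s.
Hypothesis nondeg : forall X : 'M[R]_(d 0), gram 0 *m X = s *: X ->
  L%:R * s ^+ n.+1 = n%:R * mu -> X = 0.

(* [V l] transported to the input space: on the eigenspace for [s] the
   partial products are isometries up to a power of [s]. *)
Let T k : 'M[R]_(d 0) :=
  (s ^+ k.+1)^-1 *: ((seg W 0 k.+1)^T *m V k *m seg W 0 k).

Let sX_neq0 k : s ^+ k != 0. Proof. by rewrite expf_neq0 // gt_eqF. Qed.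

Let TE k : (seg W 0 k.+1)^T *m V k *m seg W 0 k = s ^+ k.+1 *: T k.
Proof. by rewrite scalerA mulfV ?scale1r. Qed.

Let TTE k : (seg W 0 k)^T *m (V k)^T *m seg W 0 k.+1 = s ^+ k.+1 *: (T k)^T.
Proof. by rewrite -trmxZ -TE !trmx_mul trmxK mulmxA. Qed.

Let gramVseg i k : (i <= k < L)%N ->
  gram i *m ((seg W i k)^T *m (V k)^T) = s *: ((seg W i k)^T *m (V k)^T).
Proof.
move=> /andP[ik kL]; have iL := leq_trans ik (ltnW kL).
rewrite mulmxA -{1}[gram i]gramT // -trmx_mul seg_gram ?ik ?(ltnW kL) //.
by rewrite trmx_mul gramT ?(ltnW kL) // -mulmxA gramVT // scalemxAr.
Qed.

Let T_gram k : (k < L)%N -> T k *m gram 0 = s *: T k.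
Proof.
move=> kL; rewrite -scalemxAl -mulmxA seg_gram ?(ltnW kL) // -!mulmxA.
rewrite [V k *m _]mulmxA Vgram // -scalemxAl -!scalemxAr scalerA mulrC.
by rewrite -scalerA mulmxA.
Qed.

(** The partial products are invertible up to powers of [s] on the eigenspace, so [V k] is recovered
    from [T k] and it suffices to solve for the [T k]. *)
Let V_T k : (k < L)%N ->
  V k = (s ^+ k)^-1 *: (seg W 0 k.+1 *m T k *m (seg W 0 k)^T).
Proof.
move=> kL.
have VE : V k *m seg W 0 k *m (seg W 0 k)^T = s ^+ k *: V k.
  have /(congr1 trmx) := seg_segT (i := 0) (j := k) (ltnW kL) (gramVT kL).
  by rewrite !trmx_mul !trmxK trmxZ trmxK subn0.
rewrite /T -!(scalemxAl, scalemxAr) -[_ *m V k *m _]mulmxA -!mulmxA.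
rewrite (mulmxA (V k)) VE -!scalemxAr (seg_segT _ (gramV kL)) ?subn0 //.
rewrite !scalerA -[LHS]scale1r; congr (_ *: _).
move: (sX_neq0 k) (sX_neq0 k.+1); move: (s ^+ k) (s ^+ k.+1) => a b a0 b0.
by field; rewrite a0 b0.
Qed.

(** Contribution to the kernel equation of layer [l] of a varied layer above it, pulled back to the
    input space. Inserting a segment times its transpose, at the cost of [s ^+ (k - l)], restores a
    full product next to [E], so the critical equation of layer [l] applies. *)
Let term_up l k : (l < k < L)%N ->
  (seg W 0 l.+1)^T *m ((seg W k.+1 L *m V k *m seg W l.+1 k)^T *m E
    *m (seg W 0 l)^T) *m seg W 0 l = - (mu * s ^+ l.+1) *: (T k)^T.
Proof.
move=> /andP[lk kL]; have lL := ltn_trans lk kL.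
have lkL : (l.+1 <= k.+1 <= L)%N by rewrite ltnS (ltnW lk) kL.
have eigV : (V k)^T *m seg W l.+1 k.+1 *m (seg W l.+1 k.+1)^T
    = s ^+ (k - l) *: (V k)^T.
  have /(congr1 trmx) := seg_segT lkL (gramV kL).
  by rewrite !trmx_mul !trmxK trmxZ subSS.
have keyV : s ^+ (k - l) *: ((V k)^T *m (seg W k.+1 L)^T *m E *m (seg W 0 l)^T)
    = - (mu *: ((V k)^T *m seg W l k.+1)).
  transitivity ((V k)^T *m seg W l.+1 k.+1 *m (seg W l.+1 k.+1)^T
      *m (seg W k.+1 L)^T *m E *m (seg W 0 l)^T).
    by rewrite eigV -!scalemxAl.
  transitivity ((V k)^T *m seg W l.+1 k.+1
      *m ((seg W l.+1 L)^T *m E *m (seg W 0 l)^T)).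
    by rewrite -(segM W lkL) trmx_mul !mulmxA.
  by rewrite crit_seg // mulmxN -scalemxAr -mulmxA -segSl // ltnS ltnW.
apply: (scalerI (sX_neq0 (k - l))).
rewrite !trmx_mul -!mulmxA scalemxAr scalemxAr.
set Z := (X in _ *m (_ *m (_ *: X))).
have -> : Z = ((V k)^T *m (seg W k.+1 L)^T *m E *m (seg W 0 l)^T) *m seg W 0 l.
  by rewrite /Z !mulmxA.
rewrite scalemxAl keyV mulNmx -scalemxAl -mulmxA segM ?leqW ?(ltnW lk) //.
rewrite !mulmxN -!scalemxAr mulmxA -trmx_mul segM ?(ltnW lk) // mulmxA TTE.
rewrite scaleNr scalerN !scalerA; congr (- (_ *: _)).
by rewrite mulrCA -exprD addnS subnK // ltnW.
Qed.

(** The Gauss-Newton part of the Hessian: no residual occurs, and every pair of a segment and its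
    transpose becomes a power of [s]. *)
Let term_mid l k : (l < L)%N -> (k < L)%N ->
  (seg W 0 L)^T *m (seg W k.+1 L *m V k *m seg W 0 k) *m (seg W 0 l)^T
    *m seg W 0 l = s ^+ (L + l) *: T k.
Proof.
move=> lL kL.
have eigV : V k *m seg W 0 k *m (seg W 0 l)^T *m seg W 0 l
    = s ^+ l *: (V k *m seg W 0 k).
  have gV : gram 0 *m (V k *m seg W 0 k)^T = s *: (V k *m seg W 0 k)^T.
    by rewrite trmx_mul gramVseg.
  have /(congr1 trmx) := segT_seg (i := 0) (j := l) (ltnW lL) gV.
  by rewrite !trmx_mul !trmxK trmxZ !trmx_mul !trmxK subn0 ?mulmxA.
rewrite -!mulmxA [V k *m _]mulmxA -!mulmxA.
have -> : V k *m (seg W 0 k *m ((seg W 0 l)^T *m seg W 0 l))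
    = s ^+ l *: (V k *m seg W 0 k) by rewrite !mulmxA eigV.
rewrite -!scalemxAr -(segM W (k := k.+1)) ?kL // trmx_mul -!mulmxA.
rewrite [(seg W k.+1 L)^T *m _]mulmxA -[(seg W k.+1 L)^T *m _ *m _]mulmxA.
rewrite [seg W k.+1 L *m _]mulmxA -[seg W k.+1 L *m _ *m _]mulmxA.
rewrite [_ *m (V k *m _)]mulmxA [_ *m (_ *m V k *m _)]mulmxA.
rewrite (segT_seg _ (gramV kL)) ?kL ?leqnn // -scalemxAl -scalemxAr mulmxA TE.
by rewrite !scalerA -!exprD -addnA subnK // addnC.
Qed.

(** Contribution of a varied layer below [l]. Here the left factors assemble to the transpose of the
    whole product times [E], which is a multiple of [gram 0]. *)
Let term_down l k : (k < l < L)%N ->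
  (seg W 0 l.+1)^T *m ((seg W l.+1 L)^T *m E
    *m (seg W k.+1 l *m V k *m seg W 0 k)^T) *m seg W 0 l
  = - (mu * s ^+ l.+1) *: (T k)^T.
Proof.
move=> /andP[kl lL]; have kL := ltn_trans kl lL.
rewrite mulmxA mulmxA -trmx_mul segM ?lL // prod_trE mulNmx mulNmx.
rewrite -scalemxAl -scalemxAl !trmx_mul mulmxA mulmxA.
have gV : gram 0 *m ((seg W 0 k)^T *m (V k)^T)
    = s *: ((seg W 0 k)^T *m (V k)^T).
  by rewrite gramVseg.
rewrite gV -!scalemxAl.
have eigV : (V k)^T *m (seg W k.+1 l)^T *m seg W k.+1 l
    = s ^+ (l - k.+1) *: (V k)^T.
  have gV' : gram k.+1 *m V k = s *: V k by rewrite gramV.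
  have klL : (k.+1 <= l <= L)%N by rewrite kl ltnW.
  have /(congr1 trmx) := segT_seg klL gV'.
  by rewrite !trmx_mul !trmxK trmxZ.
rewrite -(segM W (i := 0) (k := k.+1) (j := l)) ?kl //.
rewrite mulmxA -!(mulmxA (seg W 0 k)^T) eigV -scalemxAl
  -scalemxAr mulmxA TTE scaleNr !scalerA.
by rewrite -!mulrA -exprD -exprS subnK.
Qed.

(** After pulling back, the kernel equation of layer [l] gives [T l + (T l)^T] by an expression in
    the total [S] that does not depend on [l]. Summing over the layers forces [S = 0], so every
    [T l] is skew-symmetric, and partial sums of the [T l] provide the generators. *)
Lemma block_gauge : exists A : forall l, 'M[R]_(d l),
  [/\ forall l, (A l)^T = - A l, A 0 = 0, A L = 0 &
      forall l, (l < L)%N -> rotate A W l = V l].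
Proof.
pose S := \sum_(k < L) T k.
have eqT l : (l < L)%N ->
    mu *: (T l + (T l)^T) = mu *: S^T - s ^+ n.+1 *: S.
  move=> lL; have := hessV lL; rewrite /hessmx !dsegE // ?(ltnW lL) //.
  move=> /(congr1 (fun Z => (seg W 0 l.+1)^T *m Z *m seg W 0 l)).
  rewrite mulmx0 mul0mx; move EE : E => E0; rewrite !(mulmxDr, mulmxDl) -{}EE.
  have -> : (seg W 0 l.+1)^T *m ((\sum_(l.+1 <= k < L)
      seg W k.+1 L *m V k *m seg W l.+1 k)^T *m E *m (seg W 0 l)^T)
      *m seg W 0 l = - (mu * s ^+ l.+1) *: \sum_(l.+1 <= k < L) (T k)^T.
    rewrite [(\sum_(_ <= _ < _) _)^T]raddf_sum !mulmx_suml !mulmx_sumr.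
    rewrite !mulmx_suml scaler_sumr; apply: eq_big_nat => k lk.
    by rewrite term_up.
  have -> : (seg W 0 l.+1)^T *m ((seg W l.+1 L)^T *m E *m (\sum_(0 <= k < l)
      seg W k.+1 l *m V k *m seg W 0 k)^T) *m seg W 0 l
      = - (mu * s ^+ l.+1) *: \sum_(0 <= k < l) (T k)^T.
    rewrite [(\sum_(_ <= _ < _) _)^T]raddf_sum !mulmx_sumr.
    rewrite !mulmx_suml scaler_sumr; apply: eq_big_nat => k lk.
    by rewrite term_down // lL andbT; case/andP: lk.
  have -> : (seg W 0 l.+1)^T *m ((seg W l.+1 L)^T *m (\sum_(0 <= k < L)
      seg W k.+1 L *m V k *m seg W 0 k) *m (seg W 0 l)^T) *m seg W 0 l
      = s ^+ (L + l) *: S.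
    rewrite !mulmxA -trmx_mul segM ?lL // !mulmx_sumr !mulmx_suml big_mkord.
    by rewrite /S scaler_sumr; apply: eq_bigr => k _; rewrite term_mid.
  rewrite -scalemxAr -scalemxAl TE.
  have -> : S^T = \sum_(0 <= k < l) (T k)^T
      + ((T l)^T + \sum_(l.+1 <= k < L) (T k)^T).
    by rewrite raddf_sum -big_ltn // -big_cat_nat ?big_mkord // ltnW.
  move: (\sum_(_ <= _ < _) _) (\sum_(_ <= _ < _) _) S (T l) => X1 X2 X3 X4 e.
  apply: (scalerI (sX_neq0 l.+1)); apply/matrixP => i j.
  have := congr1 (fun Z : 'M[R]_(d 0) => Z i j) e; rewrite !mxE.
  have -> : (L + l = n.+1 + l.+1)%N by rewrite addnS.
  rewrite exprD.
  move: (s ^+ n.+1) (s ^+ l.+1) => a b {}e.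
  apply/eqP; rewrite -subr_eq0 -[X in _ == X]e; apply/eqP; ring.
have gS : gram 0 *m S^T = s *: S^T.
  rewrite -{1}[gram 0]gramT // -trmx_mul -trmxZ mulmx_suml scaler_sumr.
  by congr (_^T); apply: eq_bigr => k _; rewrite T_gram.
have sumT : mu *: (S + S^T) = L%:R *: (mu *: S^T - s ^+ n.+1 *: S).
  transitivity (\sum_(k < L) mu *: (T k + (T k)^T)).
    by rewrite -scaler_sumr big_split /= /S raddf_sum.
  rewrite scaler_nat -[L in RHS]card_ord -sumr_const.
  by apply: eq_bigr => k _; apply: eqT.
have c_gt0 : 0 < s ^+ n.+1 by rewrite exprn_gt0.
(* Subtracting the transpose of [sumT] shows that [S] is symmetric. What remains is
   [(L s^(n+1) - n mu) S = 0], where the degenerate case falls under [nondeg], as [S^T] lies in the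
   eigenspace. *)
have S0 : S^T = 0.
  have [e|ne] := eqVneq (L%:R * s ^+ n.+1) (n%:R * mu).
    exact: nondeg.
  apply/matrixP => i j; rewrite [RHS]mxE.
  have := congr1 (fun Z : 'M[R]_(d 0) => Z i j) sumT.
  have := congr1 (fun Z : 'M[R]_(d 0) => Z j i) sumT.
  rewrite !mxE; move: (S i j) (S j i) => a b e1 e2.
  move: c_gt0 ne e1 e2; move: (s ^+ n.+1) => c c_gt0 ne e1 e2.
  have ab : a = b.
    have : (L%:R * (mu + c)) * (a - b) = 0.
      by rewrite -[RHS](subrr (mu * (a + b))) {1}[a + b]addrC e1 e2; ring.
    move/eqP; rewrite !mulf_eq0 pnatr_eq0 /= subr_eq0 gt_eqF ?addr_gt0 //=.
    by move/eqP.
  subst b; apply/eqP; move: ne; apply: contraR => a0.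
  rewrite -subr_eq0; apply/eqP/(mulIf a0); rewrite mul0r.
  rewrite -[RHS](subrr (mu * (a + a))) {2}e1.
  by rewrite -[L]addn2 natrD; ring.
have S00 : S = 0 by rewrite -[S]trmxK S0 trmx0.
have TT l : (l < L)%N -> (T l)^T = - T l.
  move=> lL; have := eqT l lL; rewrite S0 S00 !scaler0 subr0 => /eqP.
  by rewrite scaler_eq0 (negPf mu_neq0) addrC addr_eq0 => /eqP.
(* Consecutive partial sums differ by [T l], which yields [V l] after conjugation. The cap at [L]
   keeps [G l] skew-symmetric for every [l], since [T k] is controlled only for [k < L]. *)
pose G l := \sum_(0 <= k < minn l L) T k.
have GT l : (G l)^T = - G l.
  rewrite raddf_sum -sumrN; apply: eq_big_nat => k /andP[_].
  by rewrite leq_min => /andP[_ kL]; rewrite -TT.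
exists (fun l => (s ^+ l)^-1 *: (seg W 0 l *m G l *m (seg W 0 l)^T)); split.
- by move=> l; rewrite trmxZ !trmx_mul trmxK GT mulNmx mulmxN mulmxA scalerN.
- by rewrite /G min0n big_geq // mulmx0 mul0mx scaler0.
- by rewrite /G minnn big_mkord -/S S00 mulmx0 mul0mx scaler0.
move=> l lL; rewrite /rotate -!(scalemxAl, scalemxAr) (V_T lL).
have -> : seg W 0 l.+1 *m G l.+1 *m (seg W 0 l.+1)^T *m W l
    = s *: (seg W 0 l.+1 *m G l.+1 *m (seg W 0 l)^T).
  rewrite {2}(segS W (leq0n l)) trmx_mul -!mulmxA -gramE //.
  have -> : (seg W 0 l)^T *m gram l = gram 0 *m (seg W 0 l)^T.
    rewrite -{1}[gram l]gramT ?(ltnW lL) // -trmx_mul -seg_gram ?(ltnW lL) //.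
    by rewrite trmx_mul gramT.
  rewrite [G l.+1 *m _]mulmxA.
  suff -> : G l.+1 *m gram 0 = s *: G l.+1 by rewrite -!scalemxAl -scalemxAr.
  rewrite mulmx_suml scaler_sumr; apply: eq_big_nat => k /andP[_].
  by rewrite leq_min => /andP[_ kL]; rewrite T_gram.
rewrite scalerA exprSr invfM mulfVK ?gt_eqF // -scalerBr !mulmxA -segS //.
rewrite -mulmxBl -mulmxBr; congr (_ *: (_ *m _ *m _)).
rewrite /G (minn_idPl lL) (minn_idPl (ltnW lL)) big_nat_recr //=.
by rewrite addrAC subrr add0r.
Qed.

End PositiveEigenvalue.

(** * The block of the eigenvalue zero *)

Section ZeroEigenvalue.
Hypothesis s0 : s = 0.

Let gramV0 l : (l < L)%N -> gram l.+1 *m V l = 0.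
Proof. by move/gramV; rewrite s0 scale0r. Qed.

Let V0gram l : (l < L)%N -> V l *m gram l = 0.
Proof. by move/Vgram; rewrite s0 scale0r. Qed.

(** The kernel of a Gram matrix [X^T *m X] is the kernel of [X]. Hence a direction killed by the
    Gram matrices on both sides is killed by the layers adjacent to it; the next two lemmas use the
    same argument. *)
Lemma WT_block l : (l < L)%N -> (W l)^T *m V l = 0.
Proof.
move=> lL; apply: mulTmx_eq0.
rewrite trmx_mul trmxK mulmxA -(mulmxA (V l)^T) -gramS // -mulmxA.
by rewrite gramV0 ?mulmx0.
Qed.

Lemma W_block l : (l.+1 < L)%N -> W l.+1 *m V l = 0.
Proof.
move=> lL; apply: mulTmx_eq0.
rewrite trmx_mul mulmxA -(mulmxA (V l)^T) -gramE // -mulmxA.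
by rewrite gramV0 ?mulmx0 // ltnW.
Qed.

Lemma block_W l : (l.+1 < L)%N -> V l.+1 *m W l = 0.
Proof.
move=> lL; rewrite -[LHS]trmxK trmx_mul; apply/eqP; rewrite trmx_eq0; apply/eqP.
apply: mulTmx_eq0; rewrite trmx_mul !trmxK mulmxA -(mulmxA (V l.+1)).
by rewrite -gramS ?(ltnW lL) // V0gram // mul0mx.
Qed.

Lemma seg_block k j : (k.+1 < j <= L)%N -> seg W k.+1 j *m V k = 0.
Proof.
move=> /andP[kj jL]; rewrite segSl // -mulmxA W_block ?mulmx0 //.
exact: leq_trans jL.
Qed.

Lemma block_seg i k : (i < k < L)%N -> V k *m seg W i k = 0.
Proof.
case: k => [|k] /andP[// ik kL].
by rewrite segS // mulmxA block_W // mul0mx.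
Qed.

(** In a product of at least two layers, the varied layer [V k] always has a neighbour among the
    [W], and that neighbour annihilates it. The next two lemmas treat the other segments of length
    at least two. *)
Lemma dseg_block_full : dseg W V 0 L = 0.
Proof.
rewrite dsegE // big_nat_cond big1 // => k /andP[/andP[_ kL] _].
have [kL'|kL'] := ltnP k.+1 L; first by rewrite seg_block ?kL' ?leqnn ?mul0mx.
by rewrite -mulmxA block_seg ?mulmx0 //; lia.
Qed.

Lemma dseg_block_up l : (l < n)%N -> dseg W V l.+1 L = 0.
Proof.
move=> ln; rewrite dsegE; last by lia.
rewrite big_nat_cond big1 // => k /andP[/andP[_ kL] _].
have [kL'|kL'] := ltnP k.+1 L; first by rewrite seg_block ?kL' ?leqnn ?mul0mx.
by rewrite -mulmxA block_seg ?mulmx0 //; lia.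
Qed.

Lemma dseg_block_down l : (1 < l < L)%N -> dseg W V 0 l = 0.
Proof.
move=> /andP[l1 lL]; rewrite dsegE // big_nat_cond big1 //.
move=> k /andP[/andP[_ kl] _]; case: k kl => [|k] kl.
  by rewrite seg_block ?mul0mx // l1 ltnW.
by rewrite -mulmxA block_seg ?mulmx0 //= (ltn_trans kl lL).
Qed.

Hypothesis gramEV : gram L *m (E *m (V 0)^T) = 0.
Hypothesis VEgram : ((V n.+1)^T *m E) *m gram 0 = 0.

(** The only first-order variations left come from segments of length one, at [l = n] and [l = 1].
    With at least three layers they meet [W 0] or [W n.+1] across [E] and vanish, so the kernel
    equation reduces to [mu *: V l = 0]. *)
Lemma block_zero_deep : (0 < n)%N -> forall l, (l < L)%N -> V l = 0.
Proof.
move=> n0 l lL; have := hessV lL; rewrite /hessmx dseg_block_full.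
rewrite mulmx0 mul0mx addr0.
have -> : (dseg W V l.+1 L)^T *m E *m (seg W 0 l)^T = 0.
  have [ln|] := ltnP l n; first by rewrite dseg_block_up // trmx0 !mul0mx.
  rewrite leq_eqVlt => /orP[/eqP nl|nl].
    have XW : (V n.+1)^T *m E *m (W 0)^T = 0.
      rewrite -[LHS]trmxK; apply/eqP; rewrite trmx_eq0; apply/eqP.
      apply: mulTmx_eq0; rewrite trmxK !trmx_mul trmxK.
      rewrite -(mulmxA _ (W 0)^T) (mulmxA (W 0)^T) -gramE // mulmxA.
      by rewrite VEgram mul0mx.
    subst l; rewrite dsegS // dsegii mulmx0 addr0 segii mulmx1.
    by rewrite (segSl _ n0) trmx_mul mulmxA XW mul0mx.
  have {nl} ln : l = n.+1 by lia.
  by subst l; rewrite dsegii trmx0 !mul0mx.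
have -> : (seg W l.+1 L)^T *m E *m (dseg W V 0 l)^T = 0.
  have [l1|] := ltnP 1 l; first by rewrite dseg_block_down ?l1 // trmx0 mulmx0.
  case: l lL => [|[|//]] lL _; first by rewrite dsegii trmx0 mulmx0.
  rewrite dsegS // dsegii mulmx0 addr0 segii mulmx1 -mulmxA.
  have XW : (W n.+1)^T *m (E *m (V 0)^T) = 0.
    apply: mulTmx_eq0; rewrite trmx_mul trmxK -mulmxA (mulmxA (W n.+1)).
    by rewrite -gramS // gramEV mulmx0.
  by rewrite segS // trmx_mul -mulmxA XW mulmx0.
rewrite !add0r => /eqP; rewrite scaler_eq0 (negPf mu_neq0) /=.
by move/eqP.
Qed.

End ZeroEigenvalue.
End Block.
End CriticalPoint.

(** * Kernel of the Hessian *)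

(** With two layers the kernel equations become [Y *m (V 0)^T = mu *: V 1] and
    [Y^T *m V 1 = mu *: (V 0)^T]. A nonzero solution would make [mu ^+ 2] an eigenvalue of
    [Y^T *m Y]. *)
Lemma block_zero_shallow (R : realType) (d : nat -> nat) (mu : R)
    (Y : 'M[R]_(d 2, d 0)) (W V : weights R d) :
  0 < mu ->
  (forall l, (l < 2)%N -> gradmx (fun=> mu) Y W l = 0) ->
  (forall l, (l < 2)%N -> gram mu Y W l.+1 *m V l = 0) ->
  (forall l, (l < 2)%N -> V l *m gram mu Y W l = 0) ->
  (forall l, (l < 2)%N -> hessmx (fun=> mu) Y W V l = 0) ->
  (forall X : 'M[R]_(d 0, d 1), Y^T *m (Y *m X) = mu ^+ 2 *: X -> X = 0) ->
  forall l, (l < 2)%N -> V l = 0.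
Proof.
move=> mu0 critW gV Vg hV nd.
have mu_neq0 : mu != 0 by rewrite gt_eqF.
have gV0 l : (l < 2)%N -> gram mu Y W l.+1 *m V l = 0 *: V l.
  by rewrite scale0r; apply: gV.
have Vg0 l : (l < 2)%N -> V l *m gram mu Y W l = 0 *: V l.
  by rewrite scale0r; apply: Vg.
have d0 : dseg W V 0 2 = 0 := dseg_block_full mu0 critW gV0 Vg0 erefl.
have PV : seg W 0 2 *m (V 0)^T = 0.
  apply: mulTmx_eq0; rewrite trmx_mul trmxK -mulmxA.
  rewrite (segT_seg (s := 0) mu0 critW) //.
    by rewrite expr0n scale0r mulmx0.
  by rewrite scale0r -[LHS]trmxK trmx_mul trmxK (gramT mu0 critW) // Vg ?trmx0.
have PTV : (seg W 0 2)^T *m V 1 = 0.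
  by rewrite segS // trmx_mul -mulmxA (WT_block mu0 critW gV0 erefl) ?mulmx0.
have := hV 0%N isT; rewrite /hessmx d0 !dsegii mulmx0 mul0mx addr0 trmx0 mulmx0.
rewrite addr0 segii trmx1 mulmx1 dsegS // segii dsegii mulmx0 addr0 mulmx1.
move=> e0.
have := hV 1%N isT; rewrite /hessmx d0 !dsegii mulmx0 mul0mx addr0 trmx0 mul0mx.
rewrite mul0mx add0r segii trmx1 mul1mx dsegS // segii dsegii mulmx0 addr0.
rewrite mulmx1.
rewrite mulmxBl PV sub0r => /eqP; rewrite addrC subr_eq0 => /eqP e1.
have e2 : Y^T *m V 1 = mu *: (V 0)^T.
  move: e0 => /(congr1 trmx); rewrite trmx0 trmxD trmx_mul trmxK trmxZ trmxB.
  by rewrite mulmxBl PTV sub0r => /eqP; rewrite addrC subr_eq0 => /eqP.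
have V00 : V 0 = 0.
  rewrite -[LHS]trmxK; apply/eqP; rewrite trmx_eq0; apply/eqP/nd.
  by rewrite -e1 -scalemxAr e2 scalerA.
case=> [|[|//]] _ //; move: e1; rewrite V00 trmx0 mulmx0 => /eqP.
by rewrite scaler_eq0 (negPf mu_neq0) => /eqP.
Qed.

Lemma block_zero (R : realType) (d : nat -> nat) (n : nat) (mu : R)
    (Y : 'M[R]_(d n.+2, d 0)) (W V : weights R d) :
  0 < mu ->
  (forall l, (l < n.+2)%N -> gradmx (fun=> mu) Y W l = 0) ->
  (forall l, (l < n.+2)%N -> gram mu Y W l.+1 *m V l = 0) ->
  (forall l, (l < n.+2)%N -> V l *m gram mu Y W l = 0) ->
  (forall l, (l < n.+2)%N -> hessmx (fun=> mu) Y W V l = 0) ->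
  gram mu Y W n.+2 *m ((seg W 0 n.+2 - Y) *m (V 0)^T) = 0 ->
  (V n.+1)^T *m (seg W 0 n.+2 - Y) *m gram mu Y W 0 = 0 ->
  (n = 0 -> forall X : 'M[R]_(d 0, d 1),
     Y^T *m (Y *m X) = mu ^+ 2 *: X -> X = 0) ->
  forall l, (l < n.+2)%N -> V l = 0.
Proof.
case: n Y => [|n] Y mu0 critW gV Vg hV gEV VEg nd.
  by apply: (block_zero_shallow mu0 critW) => //; apply: nd.
apply: (block_zero_deep mu0 critW (s := 0)) => // l lL.
  by rewrite scale0r; apply: gV.
by rewrite scale0r; apply: Vg.
Qed.

Section KernelGauge.
Variables (R : realType) (d : nat -> nat) (n : nat).
Local Notation L := n.+2.
Variables (mu : R) (Y : 'M[R]_(d L, d 0)) (W U : weights R d).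
Hypothesis mu_gt0 : 0 < mu.
Hypothesis critW : forall l, (l < L)%N -> gradmx (fun=> mu) Y W l = 0.
Hypothesis hessU : forall l, (l < L)%N -> hessmx (fun=> mu) Y W U l = 0.

Local Notation E := (seg W 0 L - Y).
Local Notation gram := (gram mu Y W).

Let mu_neq0 : mu != 0. Proof. by rewrite gt_eqF. Qed.

Variables (T : seq R) (p : forall l, R -> 'M[R]_(d l)).
Hypothesis uT : uniq T.
Hypothesis p_spec : forall l, (l <= L)%N ->
  [/\ forall s, (p l s)^T = p l s, forall s, gram l *m p l s = s *: p l s &
      \sum_(s <- T) p l s = 1%:M].

Let pT l s : (l <= L)%N -> (p l s)^T = p l s.
Proof. by case/p_spec. Qed.

Let gramp l s : (l <= L)%N -> gram l *m p l s = s *: p l s.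
Proof. by case/p_spec. Qed.

Let sump l : (l <= L)%N -> \sum_(s <- T) p l s = 1%:M.
Proof. by case/p_spec. Qed.

Let pgram l s : (l <= L)%N -> p l s *m gram l = s *: p l s.
Proof.
move=> lL; rewrite -[LHS]trmxK trmx_mul (gramT mu_gt0 critW) // pT // gramp //.
by rewrite trmxZ pT.
Qed.

(** [gram l] is positive semidefinite, being of the form [X^T *m X]. *)
Lemma eigenproj_neg l s : (l <= L)%N -> s < 0 -> p l s = 0.
Proof.
move=> lL s0.
have [m [X gX]] : exists m (X : 'M[R]_(m, d l)), gram l = X^T *m X.
  move: lL; rewrite leq_eqVlt => /orP[/eqP ->|lL].
    exists _, (W n.+1)^T; rewrite trmxK.
    by rewrite -(gramS mu_gt0 critW (ltnSn n.+1)).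
  by exists _, (W l); rewrite (gramE mu_gt0 critW).
have e : (X *m p l s)^T *m (X *m p l s) = s *: ((p l s)^T *m p l s).
  by rewrite trmx_mul mulmxA -(mulmxA _ X^T) -gX -mulmxA gramp // scalemxAr.
apply/matrixP => i j; rewrite [RHS]mxE; apply/eqP.
have diag_ge0 k (Z : 'M[R]_(k, d l)) : 0 <= (Z^T *m Z) j j.
  by rewrite mxE sumr_ge0 // => a _; rewrite mxE -expr2 sqr_ge0.
have := diag_ge0 _ (X *m p l s); rewrite e mxE nmulr_rge0 // => le0.
have : ((p l s)^T *m p l s) j j = 0 by apply/le_anti; rewrite le0 diag_ge0.
rewrite mxE => /eqP; rewrite psumr_eq0 => [/allP|k _].
  by move=> /(_ i (mem_index_enum _)); rewrite mxE mulf_eq0 orbb.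
by rewrite mxE -expr2 sqr_ge0.
Qed.

Let Wp l s : (l < L)%N -> s \in T -> W l *m p l s = p l.+1 s *m W l.
Proof.
move=> lL; apply: intertwine_projections; rewrite ?sump ?(ltnW lL) //.
move=> a b aT bT ab.
have : (a - b) *: (p l.+1 b *m W l *m p l a) = 0.
  rewrite scalerBl scalemxAr -gramp ?(ltnW lL) // 2!scalemxAl -pgram //.
  rewrite -!mulmxA (mulmxA (W l)) (mul_gram mu_gt0 critW) // !mulmxA.
  by rewrite subrr.
by move/eqP; rewrite scaler_eq0 subr_eq0 (negPf ab) => /eqP.
Qed.

Let segp i j s : (i <= j <= L)%N -> s \in T ->
  seg W i j *m p i s = p j s *m seg W i j.
Proof.
move=> /andP[ij jL] sT; elim: j ij jL => [|j IH].
  by rewrite leqn0 => /eqP -> _; rewrite segii mul1mx mulmx1.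
rewrite leq_eqVlt => /orP[/eqP -> _|]; first by rewrite segii mul1mx mulmx1.
rewrite ltnS => ij jL; rewrite segS // -mulmxA IH ?(ltnW jL) // !mulmxA.
by rewrite Wp.
Qed.

Let segTp i j s : (i <= j <= L)%N -> s \in T ->
  p i s *m (seg W i j)^T = (seg W i j)^T *m p j s.
Proof.
move=> /andP[ij jL] sT; rewrite -[p i s]pT ?(leq_trans ij) // -trmx_mul.
by rewrite segp ?ij // trmx_mul pT.
Qed.

(** For eigenvalues [a] and [b], the off-diagonal block of [E] multiplied by [a ^+ n.+1] or by
    [b ^+ n.+1] gives the same matrix. These powers differ when [a != b] are nonnegative, and
    negative eigenvalues have zero projection. *)
Let Ep s : s \in T -> E *m p 0 s = p L s *m E.
Proof.
apply: intertwine_projections; rewrite ?sump //.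
move=> a b aT bT ab.
have [a0|a0] := ltP a 0; first by rewrite (eigenproj_neg (leq0n L) a0) mulmx0.
have [b0|b0] := ltP b 0; first by rewrite (eigenproj_neg (leqnn L) b0) !mul0mx.
have : (a ^+ n.+1 - b ^+ n.+1) *: (p L b *m E *m p 0 a) = 0.
  rewrite scalerBl -{1}mulmxA scalemxAr.
  rewrite (E_eigen mu_gt0 critW (gramp a (leq0n L))).
  rewrite (scalemxAl (b ^+ _)) (eigen_E mu_gt0 critW (pgram b (leqnn L))).
  by rewrite mulmxN mulNmx -scalemxAr -scalemxAl mulmxA subrr.
move/eqP; rewrite scaler_eq0 subr_eq0 => /orP[|/eqP //].
by rewrite eqrXn2 // (negPf ab).
Qed.

Let Yp s : s \in T -> Y *m p 0 s = p L s *m Y.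
Proof.
move=> sT; rewrite -[Y](subKr (seg W 0 L)) mulmxBl mulmxBr -segp ?leqnn //.
by rewrite -Ep.
Qed.

Definition block s : weights R d := fun l => p l.+1 s *m U l *m p l s.

Let dseg_block i j s : (i <= j <= L)%N -> s \in T ->
  dseg W (block s) i j = p j s *m dseg W U i j *m p i s.
Proof.
move=> /andP[ij jL] sT; elim: j ij jL => [|j IH].
  by rewrite leqn0 => /eqP -> _; rewrite !dsegii mulmx0 mul0mx.
rewrite leq_eqVlt => /orP[/eqP -> _|].
  by rewrite !dsegii mulmx0 mul0mx.
rewrite ltnS => ij jL; rewrite !dsegS // IH ?(ltnW jL) // mulmxDr mulmxDl.
rewrite /block -(mulmxA (_ *m U j)) -segp ?ij ?(ltnW jL) // !mulmxA.
by rewrite Wp.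
Qed.

(** All the [W l] and [E] intertwine the projections, so the Hessian commutes with taking the block
    for [s]. *)
Lemma hess_block s l : s \in T -> (l < L)%N ->
  hessmx (fun=> mu) Y W (block s) l = 0.
Proof.
move=> sT lL; transitivity (p l.+1 s *m hessmx (fun=> mu) Y W U l *m p l s).
  rewrite /hessmx !dseg_block ?lL ?leqnn ?leq0n ?(ltnW lL) //.
  move EE : E => E0; rewrite !(mulmxDr, mulmxDl) -{}EE.
  rewrite !trmx_mul !pT ?(ltnW lL) //; congr (_ + _ + _ + _).
  - rewrite -!mulmxA -(segTp (i := 0) (j := l)) ?(ltnW lL) //.
    by rewrite (mulmxA E) Ep // !mulmxA.
  - rewrite !mulmxA -(segTp (i := l.+1) (j := L)) ?lL ?leqnn // -!mulmxA.
    by rewrite (segTp (i := 0) (j := l)) ?(ltnW lL).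
  - rewrite !mulmxA (segTp (i := l.+1) (j := L)) ?lL ?leqnn //.
    by rewrite -(mulmxA (_^T) _ E) -Ep // !mulmxA.
  - by rewrite -scalemxAr -scalemxAl.
by rewrite hessU // mulmx0 mul0mx.
Qed.

Let p_ortho l s t : (l <= L)%N -> s != t -> p l s *m p l t = 0.
Proof.
move=> lL st; have : (s - t) *: (p l s *m p l t) = 0.
  by rewrite scalerBl scalemxAl -pgram // scalemxAr -gramp // mulmxA subrr.
by move/eqP; rewrite scaler_eq0 subr_eq0 (negPf st) => /eqP.
Qed.

Hypothesis nondeg_pos : forall s (X : 'M[R]_(d 0)), 0 < s ->
  gram 0 *m X = s *: X -> L%:R * s ^+ n.+1 = n%:R * mu -> X = 0.
Hypothesis nondeg_zero : n = 0 -> forall X : 'M[R]_(d 0, d 1),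
  Y^T *m (Y *m X) = mu ^+ 2 *: X -> X = 0.

Lemma block_rotate s : s \in T -> exists A : forall l, 'M[R]_(d l),
  [/\ forall l, (A l)^T = - A l, A 0 = 0, A L = 0 &
      forall l, (l < L)%N -> rotate A W l = block s l].
Proof.
move=> sT.
have gV l : (l < L)%N -> gram l.+1 *m block s l = s *: block s l.
  by move=> lL; rewrite /block !mulmxA gramp // !scalemxAl.
have Vg l : (l < L)%N -> block s l *m gram l = s *: block s l.
  by move=> lL; rewrite /block -!mulmxA pgram ?(ltnW lL) // !scalemxAr.
have hV l := @hess_block s l sT.
have [s0|s0|s0] := ltgtP s 0; last 2 first.
- by apply: (block_gauge mu_gt0 critW gV Vg hV s0) => X; apply: nondeg_pos.
- suff V0 l : (l < L)%N -> block s l = 0.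
    exists (fun=> 0); split=> // [l|l lL]; first by rewrite trmx0 oppr0.
    by rewrite /rotate mul0mx mulmx0 subrr V0.
  apply: (block_zero mu_gt0 critW) => //.
  + by move=> k kL; rewrite gV // s0 scale0r.
  + by move=> k kL; rewrite Vg // s0 scale0r.
  + rewrite /block !trmx_mul !pT // (mulmxA E) Ep // !mulmxA gramp //.
    by rewrite s0 scale0r !mul0mx.
  + rewrite /block !trmx_mul !pT // -!mulmxA (mulmxA _ E) -Ep //.
    by rewrite -!mulmxA pgram // s0 scale0r !mulmx0.
exists (fun=> 0); split=> // [l|l lL]; first by rewrite trmx0 oppr0.
by rewrite /rotate mul0mx mulmx0 subrr /block eigenproj_neg // !mul0mx.
Qed.

(** Derivative of [gram l] along [U]. Combining the kernel and critical equations shows that it is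
    also the derivative of either Gram product of the adjacent layers, as [SS] and [SE] state. *)
Let S l : 'M[R]_(d l) := - (mu^-1 *: ((dseg W U l L)^T *m E *m (seg W 0 l)^T
  + (seg W l L)^T *m dseg W U 0 L *m (seg W 0 l)^T
  + (seg W l L)^T *m E *m (dseg W U 0 l)^T)).

Let hessE l : (l < L)%N -> (dseg W U l.+1 L)^T *m E *m (seg W 0 l)^T
    + (seg W l.+1 L)^T *m dseg W U 0 L *m (seg W 0 l)^T
    + (seg W l.+1 L)^T *m E *m (dseg W U 0 l)^T = - (mu *: U l).
Proof. by move/hessU/eqP; rewrite /hessmx addr_eq0 => /eqP. Qed.

Let SS l : (l < L)%N -> S l.+1 = U l *m (W l)^T + W l *m (U l)^T.
Proof.
move=> lL; rewrite /S (segS W (leq0n l)) (dsegS W U (leq0n l)).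
have := congr1 (mulmx^~ (W l)^T) (hessE lL).
have := congr1 (mulmx^~ (U l)^T) (crit_seg critW lL).
move: (E) => E0; rewrite /= !mulmxDl !mulNmx -!mulmxA -!addrA => c e.
rewrite trmxD !trmx_mul !mulmxDr [X in _ + X]addrCA addrCA c e -opprD.
rewrite scalerN opprK -!scalemxAl -scalerDr scalerA mulVf //.
by rewrite scale1r addrC.
Qed.

Let SE l : (l < L)%N -> S l = (U l)^T *m W l + (W l)^T *m U l.
Proof.
move=> lL; rewrite /S (segSl W lL) (dsegSl W U lL).
have := congr1 (mulmx (W l)^T) (hessE lL).
have := congr1 (mulmx (U l)^T) (crit_seg critW lL).
move: (E) => E0; rewrite !mulmxDr !mulmxN -!mulmxA -!addrA => c e.
rewrite trmxD !trmx_mul !mulmxDl -!addrA addrCA -!mulmxA c e -opprD.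
rewrite scalerN opprK -!scalemxAr -scalerDr scalerA mulVf //.
by rewrite scale1r.
Qed.

Let ST l : (l <= L)%N -> (S l)^T = S l.
Proof.
rewrite leq_eqVlt => /orP[/eqP ->|lL].
  by rewrite SS // trmxD !trmx_mul !trmxK addrC.
by rewrite SE // trmxD !trmx_mul !trmxK addrC.
Qed.

(* The terms with s = t vanish because 0^-1 = 0. *)
Let Aoff l : 'M[R]_(d l) :=
  \sum_(s <- T) \sum_(t <- T) (t - s)^-1 *: (p l s *m S l *m p l t).

Let AoffT l : (l <= L)%N -> (Aoff l)^T = - Aoff l.
Proof.
move=> lL; rewrite /Aoff [RHS](congr1 -%R (exchange_big _ _ _ _ _ _)) /=.
rewrite raddf_sum -sumrN; apply: eq_bigr => s _.
rewrite raddf_sum -sumrN; apply: eq_bigr => t _ /=.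
by rewrite trmxZ !trmx_mul !pT // ST // mulmxA -scaleNr -invrN opprB.
Qed.

Let Aoff_diag l s : (l <= L)%N -> s \in T -> p l s *m Aoff l *m p l s = 0.
Proof.
move=> lL sT; rewrite mulmx_sumr mulmx_suml big1_seq // => a _.
rewrite mulmx_sumr mulmx_suml big1_seq // => b _.
rewrite -scalemxAr -scalemxAl !mulmxA.
have [->|sa] := eqVneq s a; last by rewrite p_ortho // !mul0mx scaler0.
have [->|ab] := eqVneq b a; first by rewrite subrr invr0 scale0r.
by rewrite -!mulmxA p_ortho // !mulmx0 scaler0.
Qed.

(** The Sylvester step: [S l.+1 *m W l - W l *m S l] equals [U l *m gram l - gram l.+1 *m U l],
    whose block between the eigenvalues [s] and [t] is [t - s] times that of [U l]. Division by
    [t - s] recovers all off-diagonal blocks of [U l]. *)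
Let Aoff_rotate l : (l < L)%N ->
  rotate Aoff W l + \sum_(s <- T) block s l = U l.
Proof.
move=> lL; rewrite -[RHS]mul1mx -(sump lL) mulmx_suml.
rewrite /rotate /Aoff mulmx_suml mulmx_sumr -sumrB -big_split /=.
apply: eq_big_seq => s sT; rewrite -[RHS]mulmx1 -(sump (ltnW lL)) mulmx_sumr.
rewrite mulmx_suml mulmx_sumr -sumrB.
rewrite (bigD1_seq s) //= [RHS](bigD1_seq s) //= subrr invr0 !scale0r.
rewrite mul0mx mulmx0 subrr add0r addrC; congr (_ + _).
rewrite big_seq_cond [RHS]big_seq_cond; apply: eq_bigr => t /andP[tT ts].
rewrite -scalemxAl -scalemxAr -scalerBr.
have ts0 : t - s != 0 by rewrite subr_eq0.
apply: (scalerI ts0); rewrite scalerA mulfV // scale1r.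
rewrite -(mulmxA _ _ (W l)) -Wp // !mulmxA Wp // -!mulmxA -mulmxBr !mulmxA.
rewrite -mulmxBl SS // SE // mulmxDl mulmxDr !mulmxA [X in _ - X]addrC.
rewrite opprD addrACA subrr addr0 -(gramS mu_gt0 critW lL).
rewrite -[U l *m _ *m _]mulmxA -(gramE mu_gt0 critW lL).
rewrite mulmxBr mulmxBl -!mulmxA gramp ?(ltnW lL) // !mulmxA.
by rewrite pgram // scalerBl -!scalemxAl -!scalemxAr.
Qed.

Lemma kernel_gauge_spec : exists A : forall l, 'M[R]_(d l),
  [/\ forall l, (l <= L)%N -> (A l)^T = - A l, A L *m Y = Y *m A 0 &
      forall l, (l < L)%N -> rotate A W l = U l].
Proof.
have H s : exists A : forall l, 'M[R]_(d l), s \in T ->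
    [/\ forall l, (A l)^T = - A l, A 0 = 0, A L = 0 &
      forall l, (l < L)%N -> rotate A W l = block s l].
  have [sT|_] := boolP (s \in T); last by exists (fun=> 0).
  by have [A PA] := block_rotate sT; exists A.
pose Ab s := projT1 (cid (H s)).
have AbP s (sT : s \in T) := projT2 (cid (H s)) sT.
pose A l := Aoff l + \sum_(s <- T) Ab s l.
have AT l : (l <= L)%N -> (A l)^T = - A l.
  move=> lL; rewrite trmxD AoffT // opprD; congr (_ + _).
  rewrite raddf_sum -sumrN; apply: eq_big_seq => s sT.
  by have [AbT _ _ _] := AbP s sT; apply: AbT.
have AU l : (l < L)%N -> rotate A W l = U l.
  move=> lL; rewrite -[RHS]Aoff_rotate // /rotate /A mulmxDl mulmxDr opprD.
  rewrite addrACA; congr (_ + _); rewrite mulmx_suml mulmx_sumr -sumrB.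
  apply: eq_big_seq => s sT; have [_ _ _ /(_ l lL) <-] := AbP s sT.
  by [].
have A0 : A 0 = Aoff 0.
  rewrite /A big1_seq ?addr0 // => s /andP[_ sT].
  by have [_ + _ _] := AbP s sT.
have AL : A L = Aoff L.
  rewrite /A big1_seq ?addr0 // => s /andP[_ sT].
  by have [_ _ + _] := AbP s sT.
(* Compatibility with [Y]: as [U] is in the kernel and [W] is critical, the formula for the Hessian
   along a rotation leaves only the term in the defect [B]. The first and last layers show that [B]
   vanishes off the zero eigenspaces. *)
exists A; split=> //; apply/eqP; rewrite -subr_eq0; apply/eqP.
move BE : (_ - _) => B.
have segB l : (l < L)%N -> (seg W l.+1 L)^T *m B *m (seg W 0 l)^T = 0.
  move=> lL; have := hessmx_rotate (fun=> mu) Y W AT lL.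
  rewrite (hessmx_ext _ _ _ AU lL) hessU // critW // mulmx0 mul0mx subrr add0r.
  by rewrite BE => <-.
have pB s : s != 0 -> p L s *m B = 0.
  move=> s0; have := segB 0%N isT; rewrite segii trmx1 mulmx1 => sB.
  have iL : (1 <= L <= L)%N by rewrite leqnn.
  have /(congr1 trmx) := seg_segT mu_gt0 critW iL (gramp s (leqnn L)).
  rewrite !trmx_mul trmxK trmxZ !pT // => /(congr1 (mulmx^~ B)) /=.
  rewrite -(mulmxA _ _ B) sB mulmx0 -scalemxAl => /esym/eqP.
  by rewrite scaler_eq0 expf_eq0 (negPf s0) andbF => /eqP.
have Bp t : t != 0 -> B *m p 0 t = 0.
  move=> t0; have := segB n.+1 (ltnSn _); rewrite segii trmx1 mul1mx => sB.
  have iL : (0 <= n.+1 <= L)%N by rewrite leqnSn.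
  have := segT_seg mu_gt0 critW iL (gramp t (leq0n L)).
  move=> /(congr1 (mulmx B)); rewrite (mulmxA B) sB mul0mx -scalemxAr.
  move=> /esym/eqP.
  by rewrite scaler_eq0 expf_eq0 (negPf t0) andbF => /eqP.
rewrite -[B]mul1mx -(sump (leqnn L)) mulmx_suml big1_seq // => s /andP[_ sT].
have [s0|s0] := eqVneq s 0; last by rewrite pB.
rewrite -[LHS]mulmx1 -(sump (leq0n L)) mulmx_sumr big1_seq // => t /andP[_ tT].
have [ts|ts] := eqVneq t s; last by rewrite -mulmxA Bp ?mulmx0 // -s0.
(* On the zero block, [Y] preserves the decomposition while [Aoff] has no diagonal blocks, so [B]
   vanishes there too. *)
rewrite ts -BE AL A0 mulmxBr mulmxBl -!mulmxA Yp // !mulmxA Aoff_diag //.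
by rewrite -Yp // -!mulmxA (mulmxA (p 0 s)) Aoff_diag // !mulmx0 mul0mx subrr.
Qed.

End KernelGauge.

Lemma kernel_gauge (R : realType) (d : nat -> nat) (n : nat) (mu : R)
    (Y : 'M[R]_(d n.+2, d 0)) (W U : weights R d) :
  0 < mu ->
  (forall l, (l < n.+2)%N -> gradmx (fun=> mu) Y W l = 0) ->
  (forall l, (l < n.+2)%N -> hessmx (fun=> mu) Y W U l = 0) ->
  (forall s (X : 'M[R]_(d 0)), 0 < s -> gram mu Y W 0 *m X = s *: X ->
     n.+2%:R * s ^+ n.+1 = n%:R * mu -> X = 0) ->
  (n = 0 -> forall X : 'M[R]_(d 0, d 1),
     Y^T *m (Y *m X) = mu ^+ 2 *: X -> X = 0) ->
  exists A : forall l, 'M[R]_(d l),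
  [/\ forall l, (l <= n.+2)%N -> (A l)^T = - A l, A n.+2 *m Y = Y *m A 0 &
      forall l, (l < n.+2)%N -> rotate A W l = U l].
Proof.
move=> mu0 critW hessU nd1 nd2.
have [T [p [uT pP]]] := common_spectral (gramT mu0 critW).
exact: (kernel_gauge_spec mu0 critW hessU uT pP).
Qed.

(** * Rescaling to equal weights, and the degeneracies excluded by (A2) *)

Lemma singular_value_mx (R : realType) m n k (Y : 'M[R]_(m, n))
    (X : 'M[R]_(n, k)) (Z : 'M[R]_(m, k)) y :
  0 < y -> X != 0 -> Y *m X = y *: Z -> Y^T *m Z = y *: X ->
  singular_value Y y.
Proof.
move=> y0 /matrix0Pn[i [j Xij]] YX YZ; split; first exact: ltW.
have v0 : X *m delta_mx j (0 : 'I_1) != 0.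
  by rewrite -colE; apply/matrix0Pn; exists i, 0; rewrite mxE.
have eu : Y^T *m (Z *m delta_mx j (0 : 'I_1)) = y *: (X *m delta_mx j 0).
  by rewrite mulmxA YZ scalemxAl.
exists (Z *m delta_mx j 0), (X *m delta_mx j 0); split=> //.
  apply: contraNneq v0 => u0; move: eu; rewrite u0 mulmx0 => /esym/eqP.
  by rewrite scaler_eq0 gt_eqF.
by rewrite mulmxA YX scalemxAl.
Qed.

(** With [b = n / (2 (n + 1))] the two exponents are [1 - b] and [b], so the bracket factors as
    [(1 + a)] times [a] to the power [- b]. *)
Lemma threshold_powR (R : realType) (n : nat) : (0 < n)%N ->
  let a := n%:R / n.+2%:R : R in
  (a `^ (n.+2%:R / (2 * n.+1%:R)) + a^-1 `^ (n%:R / (2 * n.+1%:R)))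
    ^+ (2 * n.+1) = (1 + a) ^+ (2 * n.+1) / a ^+ n.
Proof.
move=> n0 a; have a0 : 0 < a by rewrite divr_gt0 ?ltr0n.
set b := n%:R / (2 * n.+1%:R).
have n1 : (n.+1%:R : R) != 0 by rewrite pnatr_eq0.
have -> : n.+2%:R / (2 * n.+1%:R) = 1 + - b.
  rewrite /b -[n.+2]addn2 -[n.+1]addn1 !natrD; field.
  by rewrite natr1.
rewrite powRD; last by apply/implyP => _; rewrite gt_eqF.
rewrite powRr1 ?ltW // -powR_inv1 ?ltW // -powRrM mulN1r -{2}[a `^ - b]mul1r.
rewrite -mulrDl exprMn [a + 1]addrC; congr (_ * _).
rewrite -[LHS]powR_mulrn ?powR_ge0 // -powRrM.
have -> : - b * (2 * n.+1)%:R = - n%:R by rewrite /b natrM; field.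
by rewrite powRN powR_mulrn ?ltW.
Qed.

Section Rescaling.
Variables (R : realType) (d : nat -> nat) (n : nat).
Local Notation L := n.+2.
Variables (lam : nat -> R) (Y : 'M[R]_(d L, d 0)) (W U : weights R d).
Hypothesis lam_gt0 : forall l, (l < L)%N -> 0 < lam l.

(** Multiplying the objective by [mu], the product of the [lam l], and each layer by the square root
    of its [lam l] gives the same problem with all weights equal to [mu] and target [C 0 L *: Y]. *)
Let c l := Num.sqrt (lam l).
Let C i j := \prod_(i <= k < j) c k.
Let sc (V : weights R d) : weights R d := fun l => c l *: V l.

Lemma seg_scale V i j : (i <= j)%N -> seg (sc V) i j = C i j *: seg V i j.
Proof.
elim: j => [|j IH].
  by rewrite leqn0 => /eqP ->; rewrite !segii /C big_geq ?scale1r.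
rewrite leq_eqVlt => /orP[/eqP ->|].
  by rewrite !segii /C big_geq ?scale1r.
rewrite ltnS => ij; rewrite !segS // IH // /C big_nat_recr //=.
by rewrite -scalemxAl -scalemxAr scalerA mulrC.
Qed.

Lemma dseg_scale V i j : (i <= j)%N ->
  dseg (sc W) (sc V) i j = C i j *: dseg W V i j.
Proof.
elim: j => [|j IH].
  by rewrite leqn0 => /eqP ->; rewrite !dsegii scaler0.
rewrite leq_eqVlt => /orP[/eqP ->|]; first by rewrite !dsegii scaler0.
rewrite ltnS => ij; rewrite !dsegS // IH // seg_scale // /C big_nat_recr //=.
by rewrite -!scalemxAl -!scalemxAr !scalerA -scalerDr mulrC.
Qed.

Let mu := \prod_(k < L) lam k.

Let c_gt0 l : (l < L)%N -> 0 < c l.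
Proof. by move=> lL; rewrite sqrtr_gt0 lam_gt0. Qed.

Let C_sqr : C 0 L ^+ 2 = mu.
Proof.
rewrite /C /mu -(big_mkord xpredT lam) -prodrXl; apply: eq_big_nat => k kL.
by rewrite sqr_sqrtr // ltW // lam_gt0.
Qed.

Let mu_gt0 : 0 < mu.
Proof. by apply: prodr_gt0 => k _; apply: lam_gt0. Qed.

Let C_split l : (l < L)%N -> C l.+1 L * C 0 l * c l = C 0 L.
Proof.
move=> lL; rewrite [RHS](big_cat_nat (n := l)) ?(ltnW lL) //=.
rewrite [X in _ = _ * X]big_ltn // /C.
by rewrite [RHS]mulrCA mulrC mulrA mulrAC mulrA.
Qed.

Let C_coef l : (l < L)%N -> C l.+1 L * C 0 L * C 0 l = mu / c l.
Proof.
move=> lL; rewrite -C_sqr expr2 -{2}(C_split lL).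
by field; rewrite gt_eqF ?c_gt0.
Qed.

Let mu_coef l : (l < L)%N -> mu * c l = mu / c l * lam l.
Proof.
move=> lL; rewrite -[lam l]sqr_sqrtr ?ltW ?lam_gt0 // expr2 mulrA mulfVK //.
by rewrite gt_eqF ?c_gt0.
Qed.

Lemma gradmx_scale l : (l < L)%N ->
  gradmx (fun=> mu) (C 0 L *: Y) (sc W) l = (mu / c l) *: gradmx lam Y W l.
Proof.
move=> lL; rewrite /gradmx !seg_scale // ?(ltnW lL) // -scalerBr !trmxZ.
rewrite -!(scalemxAl, scalemxAr) !scalerA scalerDr scalerA -mu_coef //.
by rewrite -C_coef //; congr (_ *: _ + _); ring.
Qed.

Lemma hessmx_scale l : (l < L)%N ->
  hessmx (fun=> mu) (C 0 L *: Y) (sc W) (sc U) l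
  = (mu / c l) *: hessmx lam Y W U l.
Proof.
move=> lL; rewrite /hessmx !dseg_scale ?(ltnW lL) //.
rewrite !seg_scale ?(ltnW lL) //.
rewrite -scalerBr !trmxZ -!(scalemxAl, scalemxAr) !scalerA !scalerDr scalerA.
rewrite -mu_coef // -C_coef //.
by congr (_ *: _ + _ *: _ + _ *: _ + _); ring.
Qed.

Hypothesis A2_2 : L = 2 -> forall y, singular_value Y y -> 0 < y ->
  mu != y ^+ 2.
Hypothesis A2_3 : (3 <= L)%N -> forall y, singular_value Y y -> 0 < y ->
  mu != y ^+ (2 * L.-1) /
    ((((L%:R - 2) / L%:R) `^ (L%:R / (2 * L.-1%:R))
      + (L%:R / (L%:R - 2)) `^ ((L%:R - 2) / (2 * L.-1%:R))) ^+ (2 * L.-1)).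
Hypothesis critW : forall l, (l < L)%N -> gradmx lam Y W l = 0.
Hypothesis hessU : forall l, (l < L)%N -> hessmx lam Y W U l = 0.

Let C_gt0 : 0 < C 0 L.
Proof. by rewrite /C big_mkord prodr_gt0 // => k _; apply: c_gt0. Qed.

Let C_neq0 : C 0 L != 0. Proof. by rewrite gt_eqF. Qed.

Let critW' l : (l < L)%N ->
  gradmx (fun=> mu) (C 0 L *: Y) (sc W) l = 0.
Proof. by move=> lL; rewrite gradmx_scale // critW // scaler0. Qed.

(** Undoing the scaling gives [Y^T *m (Y *m X) = mu *: X], so a nonzero [X] would make the square
    root of [mu] a singular value of [Y]. *)
Lemma nondeg_shallow m : n = 0 -> forall X : 'M[R]_(d 0, m),
  (C 0 L *: Y)^T *m ((C 0 L *: Y) *m X) = mu ^+ 2 *: X -> X = 0.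
Proof.
move=> n0 X XE; apply/eqP; apply: contraTT isT => X0.
have mu0 : mu != 0 by rewrite gt_eqF.
have {}XE : Y^T *m (Y *m X) = mu *: X.
  apply: (scalerI mu0); rewrite [RHS]scalerA -expr2 -XE trmxZ.
  by rewrite -!(scalemxAl, scalemxAr) !scalerA -expr2 C_sqr.
suff sv : singular_value Y (C 0 L).
  have := A2_2 (congr1 (fun k => k.+2) n0) sv C_gt0.
  by rewrite C_sqr eqxx.
apply: (singular_value_mx (Z := (C 0 L)^-1 *: (Y *m X)) C_gt0 X0).
  by rewrite scalerA mulfV // scale1r.
by rewrite -scalemxAr XE scalerA -C_sqr expr2 mulKf.
Qed.

(** In the degenerate case, the columns of [X] and of [P *m X] are right and left singular vectors
    of [Y], and the singular value computed from [s] satisfies the equality that (A2) forbids. *)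
Lemma nondeg_deep m s (X : 'M[R]_(d 0, m)) : 0 < s ->
  gram mu (C 0 L *: Y) (sc W) 0 *m X = s *: X ->
  L%:R * s ^+ n.+1 = n%:R * mu -> X = 0.
Proof.
move=> s0 gX sE; apply/eqP; apply: contraTT isT => X0.
have [n0|n0] := posnP n.
  move: sE; rewrite n0 mul0r => /eqP; rewrite mulf_eq0 pnatr_eq0 /=.
  by rewrite expf_eq0 /= gt_eqF.
pose a : R := n%:R / L%:R.
have a0 : 0 < a by rewrite divr_gt0 ?ltr0n.
have sE' : s ^+ n.+1 = a * mu.
  apply: (mulfI (_ : L%:R != 0)); first by rewrite pnatr_eq0.
  by rewrite sE /a mulrA mulrCA mulfV ?mulr1 // pnatr_eq0.
set Y' := C 0 L *: Y in gX; set P := seg (sc W) 0 L.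
(* [E_eigen] with [s ^+ n.+1 = a * mu] reads [a Y' X = (a + 1) P X], whence the factor [k]. *)
pose k := 1 + a^-1; have k0 : 0 < k by rewrite addr_gt0 ?invr_gt0.
have YX : Y' *m X = k *: (P *m X).
  have := E_eigen mu_gt0 critW' gX; rewrite sE' -/P -/Y' mulmxBl => e.
  have amu : a * mu != 0 by rewrite mulf_neq0 ?gt_eqF.
  apply: (scalerI amu); rewrite -[LHS](subKr ((a * mu) *: (P *m X))) -scalerBr.
  rewrite e opprK -scalerDl scalerA; congr (_ *: _).
  by rewrite /k; field; rewrite gt_eqF.
have YP : Y'^T *m (P *m X) = (k * s ^+ n.+2) *: X.
  have PY : P^T *m Y' = P^T *m P + mu *: gram mu Y' (sc W) 0.
    have := prod_trE Y' (sc W) mu_gt0; rewrite -/P mulmxBr => e.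
    by rewrite -[mu *: _]opprK -e opprB addrC subrK.
  have : Y'^T *m P = P^T *m P + mu *: gram mu Y' (sc W) 0.
    rewrite -[LHS]trmxK trmx_mul trmxK PY trmxD trmx_mul trmxK trmxZ.
    by rewrite (gramT mu_gt0 critW').
  move=> e; rewrite mulmxA e mulmxDl -mulmxA.
  rewrite (segT_seg mu_gt0 critW' (i := 0) (j := L) _ gX) ?leqnn //.
  rewrite subn0 -scalemxAl gX scalerA -scalerDl; congr (_ *: _).
  rewrite /k mulrDl mul1r; congr (_ + _).
  by rewrite (exprS s) sE'; field; rewrite gt_eqF.
have [r r0 rE] : exists2 r, 0 < r & s ^+ n.+2 = r ^+ 2.
  exists (Num.sqrt (s ^+ n.+2)); first by rewrite sqrtr_gt0 exprn_gt0.
  by rewrite sqr_sqrtr ?exprn_ge0 // ltW.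
(* [r] is the factor by which [P] stretches the eigenspace, and division by [C 0 L] passes from [Y']
   back to [Y]. *)
pose y := k * r / C 0 L.
have y0 : 0 < y by rewrite divr_gt0 ?mulr_gt0.
have y2 : y ^+ 2 = k ^+ 2 * s * a.
  rewrite /y expr_div_n exprMn C_sqr -rE.
  by rewrite (exprS s) sE'; field; rewrite gt_eqF.
have sv : singular_value Y y.
  apply: (singular_value_mx (Z := r^-1 *: (P *m X)) y0 X0).
    apply: (scalerI C_neq0); rewrite scalemxAl -/Y' YX !scalerA; congr (_ *: _).
    by rewrite /y; field; rewrite !gt_eqF.
  apply: (scalerI C_neq0); rewrite scalemxAl -trmxZ -/Y' -scalemxAr YP !scalerA.
  congr (_ *: _).
  by rewrite rE /y; field; rewrite !gt_eqF.
have L3 : (3 <= L)%N by [].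
have := A2_3 L3 sv y0; rewrite /= [_ - 2](_ : _ = n%:R); last first.
  by rewrite -[L]addn2 natrD addrK.
rewrite -[L%:R / n%:R]invf_div -/a threshold_powR // [y ^+ _]exprM y2.
case/eqP; have q0 : 0 < 1 + a by rewrite addr_gt0.
have -> : k ^+ 2 * s * a = (1 + a) ^+ 2 * s / a.
  by rewrite /k; field; rewrite gt_eqF.
rewrite expr_div_n exprMn sE' -exprM (exprS a).
move: (exprn_gt0 n a0) (exprn_gt0 (2 * n.+1) q0).
move: (a ^+ n) ((1 + a) ^+ _) => u v u0 v0.
by field; rewrite !gt_eqF.
Qed.

Lemma kernel_gauge_scaled : exists A : forall l, 'M[R]_(d l),
  [/\ forall l, (l <= L)%N -> (A l)^T = - A l, A L *m Y = Y *m A 0 &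
      forall l, (l < L)%N -> rotate A W l = U l].
Proof.
have hessU' l : (l < L)%N -> hessmx (fun=> mu) (C 0 L *: Y) (sc W) (sc U) l = 0.
  by move=> lL; rewrite hessmx_scale // hessU // scaler0.
have [A [AT AY AU]] := kernel_gauge mu_gt0 critW' hessU'
  (fun s X => @nondeg_deep _ s X) (fun e => @nondeg_shallow _ e).
exists A; split=> // [|l lL].
  by apply: (scalerI C_neq0); rewrite scalemxAr scalemxAl.
have c0 : c l != 0 by rewrite gt_eqF ?c_gt0.
apply: (scalerI c0); rewrite -[RHS]/(sc U l) -AU // /rotate /sc.
by rewrite -scalemxAr -scalemxAl scalerBr.
Qed.

End Rescaling.

(** * Gradient and symmetries *)

Section Frobenius.
Variable R : realType.

Definition fdot m n (A B : 'M[R]_(m, n)) : R := \sum_i \sum_j A i j * B i j.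

Lemma fdot_frob2 m n (A : 'M[R]_(m, n)) : fdot A A = frob2 A.
Proof. by apply: eq_bigr => i _; apply: eq_bigr => j _; rewrite expr2. Qed.

Lemma fdotE m n (A B : 'M[R]_(m, n)) : fdot A B = \tr (A^T *m B).
Proof.
rewrite /fdot exchange_big /=; apply: eq_bigr => j _; rewrite mxE.
by apply: eq_bigr => i _; rewrite mxE.
Qed.

Lemma fdot_delta m n (A : 'M[R]_(m, n)) i j : fdot A (delta_mx i j) = A i j.
Proof.
rewrite /fdot (bigD1 i) //= (bigD1 j) //= mxE !eqxx mulr1 !big1 ?addr0 //.
  by move=> k ki; apply: big1 => l _; rewrite mxE (negPf ki) mulr0.
by move=> l lj; rewrite mxE (negPf lj) andbF mulr0.
Qed.

Lemma fdot_adjoint m n p q (A : 'M[R]_(m, n)) (B : 'M[R]_(m, p))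
    (C : 'M[R]_(q, n)) (X : 'M[R]_(p, q)) :
  fdot A (B *m X *m C) = fdot (B^T *m A *m C^T) X.
Proof. by rewrite !fdotE !trmx_mul !trmxK !mulmxA mxtrace_mulC !mulmxA. Qed.

Lemma frob2D m n (A B : 'M[R]_(m, n)) (t : R) :
  frob2 (A + t *: B) = frob2 A + (2 * fdot A B) * t + frob2 B * t ^+ 2.
Proof.
rewrite /frob2 /fdot mulr_sumr !mulr_suml -!big_split; apply: eq_bigr => i _ /=.
rewrite mulr_sumr !mulr_suml -!big_split; apply: eq_bigr => j _ /=.
by rewrite !mxE; ring.
Qed.

Lemma frob2_ge0 m n (A : 'M[R]_(m, n)) : 0 <= frob2 A.
Proof. by apply: sumr_ge0 => i _; apply: sumr_ge0 => j _; apply: sqr_ge0. Qed.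

Lemma entry_le_frob2 m n (A : 'M[R]_(m, n)) i j : A i j ^+ 2 <= frob2 A.
Proof.
rewrite /frob2 (bigD1 i) //= (bigD1 j) //= -addrA lerDl addr_ge0 //.
  by apply: sumr_ge0 => k _; apply: sqr_ge0.
by apply: sumr_ge0 => k _; apply: sumr_ge0 => l _; apply: sqr_ge0.
Qed.

Lemma frob2Z m n (A : 'M[R]_(m, n)) a : frob2 (a *: A) = a ^+ 2 * frob2 A.
Proof.
rewrite /frob2 mulr_sumr; apply: eq_bigr => i _; rewrite mulr_sumr.
by apply: eq_bigr => j _; rewrite mxE exprMn.
Qed.

Lemma derive1_quadratic (a b c : R) :
  derive1 (fun t : R => a + b * t + c * t ^+ 2) 0 = b.
Proof.
pose p : {poly R} := a%:P + b *: 'X + c *: 'X^2.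
have -> : (fun t : R => a + b * t + c * t ^+ 2) = horner p.
  by apply/funext => t; rewrite /p !hornerE.
rewrite derive1E (@derive_val _ _ _ _ _ _ _ (is_derive_poly p 0)).
rewrite /p !derivD !derivZ derivC derivX derivXn !(hornerD, hornerZ, hornerC).
by rewrite hornerXn mulr1 add0r /= expr1 addr0 mulr0 addr0.
Qed.

End Frobenius.

Section Gradient.
Variables (R : realType) (d : nat -> nat) (L : nat).
Variables (lam : nat -> R) (Y : 'M[R]_(d L, d 0)).
Implicit Types W V : weights R d.

(** Only one layer moves, so the whole product is affine in [t]. The objective is therefore
    quadratic in [t], and its derivative at zero is the linear coefficient. *)
Lemma prodW_line W (l : 'I_L) (i : 'I_(d l.+1)) (j : 'I_(d l)) t :
  prodW (fun k => W k + t *: @Edir R d l i j k) L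
  = prodW W L + t *: (seg W l.+1 L *m delta_mx i j *m seg W 0 l).
Proof.
have EdirE : @Edir R d l i j l = delta_mx i j.
  by apply/matrixP => a b; rewrite !mxE eqxx.
have Edir0 (k : nat) : k != l -> @Edir R d l i j k = 0.
  by move=> kl; apply/matrixP => a b; rewrite !mxE (negPf kl).
have lL := ltn_ord l.
set Wt : weights R d := fun k => W k + t *: @Edir R d l i j k.
have e1 : seg Wt 0 l = seg W 0 l.
  apply: seg_ext => // k /andP[_ kl]; rewrite /Wt Edir0 ?scaler0 ?addr0 //.
  by rewrite neq_ltn kl.
have e2 : seg Wt l.+1 L = seg W l.+1 L.
  apply: seg_ext => // k /andP[lk _]; rewrite /Wt Edir0 ?scaler0 ?addr0 //.
  by rewrite neq_ltn lk orbT.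
rewrite -!seg0 -(segM Wt (k := l.+1)) // segS // e1 e2 /Wt EdirE.
rewrite -[in RHS](segM W (k := l.+1)) // segS // mulmxDl mulmxDr.
by rewrite -scalemxAl -scalemxAr !mulmxA.
Qed.

Lemma gradF_gradmx W (l : 'I_L) (i : 'I_(d l.+1)) (j : 'I_(d l)) :
  gradF lam Y W l i j = 2 * gradmx lam Y W l i j.
Proof.
have EdirE : @Edir R d l i j l = delta_mx i j.
  by apply/matrixP => a b; rewrite !mxE eqxx.
have Edir0 (k : nat) : k != l -> @Edir R d l i j k = 0.
  by move=> kl; apply/matrixP => a b; rewrite !mxE (negPf kl).
set N := seg W l.+1 L *m delta_mx i j *m seg W 0 l.
rewrite /gradF.
have -> : (fun t => Fobj lam Y (fun k => W k + t *: Edir R d l i j k))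
  = (fun t => (frob2 (prodW W L - Y) + \sum_(k < L) lam k * frob2 (W k))
      + (2 * (fdot (prodW W L - Y) N + lam l * fdot (W l) (delta_mx i j))) * t
      + (frob2 N + lam l * frob2 (delta_mx i j : 'M[R]_(d l.+1, d l)))
        * t ^+ 2).
  apply/funext => t; rewrite /Fobj prodW_line addrAC frob2D.
  rewrite (bigD1 l) //= [in RHS](bigD1 l) //= EdirE frob2D.
  rewrite (eq_bigr (fun k : 'I_L => lam k * frob2 (W k))); last first.
    by move=> k kl; rewrite Edir0 ?scaler0 ?addr0.
  by ring.
rewrite derive1_quadratic fdot_delta fdot_adjoint fdot_delta -seg0.
by congr (2 * _); rewrite !mxE.
Qed.

Lemma critsetP V : critset lam Y V <->
  forall l, (l < L)%N -> gradmx lam Y V l = 0.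
Proof.
split=> [cV l lL|gV l i j]; last by rewrite gradF_gradmx gV // mxE mulr0.
apply/matrixP => i j; rewrite [RHS]mxE; have := cV (Ordinal lL) i j.
by rewrite gradF_gradmx => /eqP; rewrite mulf_eq0 pnatr_eq0 => /eqP.
Qed.

Lemma gradnorm2E W :
  gradnorm2 lam Y W = \sum_(l < L) 4 * frob2 (gradmx lam Y W l).
Proof.
apply: eq_bigr => l _; rewrite mulr_sumr; apply: eq_bigr => i _.
rewrite mulr_sumr; apply: eq_bigr => j _; rewrite gradF_gradmx exprMn.
by congr (_ * _); ring.
Qed.

(** Bounds the critical set for the compactness argument. Pairing the critical equation with [V l]
    gives [- fdot P (P - Y)] for the end-to-end product [P], and completing the square bounds this
    by a quarter of [frob2 Y]. *)
Lemma crit_bound V l : (l < L)%N -> gradmx lam Y V l = 0 ->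
  lam l * frob2 (V l) <= frob2 Y / 4.
Proof.
move=> lL gV; have : fdot (V l) (gradmx lam Y V l) = 0.
  by rewrite gV; apply: big1 => i _; apply: big1 => j _; rewrite mxE mulr0.
have -> : fdot (V l) (gradmx lam Y V l)
    = fdot (seg V 0 L) (seg V 0 L - Y) + lam l * frob2 (V l).
  rewrite -fdot_frob2 /gradmx.
  have -> : fdot (seg V 0 L) (seg V 0 L - Y)
      = fdot (V l) ((seg V l.+1 L)^T *m (seg V 0 L - Y) *m (seg V 0 l)^T).
    by rewrite fdot_adjoint !trmxK -mulmxA -segS // segM ?lL.
  rewrite /fdot mulr_sumr -big_split; apply: eq_bigr => i _ /=.
  rewrite mulr_sumr -big_split; apply: eq_bigr => j _ /=.
  by rewrite !mxE; ring.
set P := seg V 0 L => /eqP; rewrite addrC addr_eq0 => /eqP ->.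
have := frob2_ge0 (P + (- (1 / 2)) *: Y); rewrite frob2D => ge0.
have -> : fdot P (P - Y) = frob2 P - fdot P Y.
  rewrite -fdot_frob2 /fdot -sumrB; apply: eq_bigr => i _ /=.
  by rewrite -sumrB; apply: eq_bigr => j _; rewrite !mxE mulrBr.
by lra.
Qed.

Definition act (Q : forall l, 'M[R]_(d l)) V : weights R d :=
  fun k => Q k.+1 *m V k *m (Q k)^T.

Lemma seg_act Q V i j : (forall l, (l <= L)%N -> (Q l)^T *m Q l = 1%:M) ->
  (i <= j <= L)%N -> seg (act Q V) i j = Q j *m seg V i j *m (Q i)^T.
Proof.
move=> QQ /andP[ij]; elim: j ij => [|j IH].
  rewrite leqn0 => /eqP -> _; rewrite !segii mulmx1.
  by apply/esym/mulmx1C/QQ.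
rewrite leq_eqVlt => /orP[/eqP <- iL|].
  by rewrite !segii mulmx1; apply/esym/mulmx1C/QQ.
rewrite ltnS => ij jL; rewrite !segS // IH ?(ltnW jL) // /act.
by rewrite !mulmxA -(mulmxA _ (Q j)^T) QQ ?(ltnW jL) // mulmx1.
Qed.

(** The gradient is equivariant under orthogonal changes of basis fixing [Y], so this action
    preserves the critical set. *)
Lemma gradmx_act (Q : forall l, 'M[R]_(d l)) V l :
  (forall l, (l <= L)%N -> (Q l)^T *m Q l = 1%:M) ->
  Q L *m Y = Y *m Q 0 -> (l < L)%N ->
  gradmx lam Y (act Q V) l = Q l.+1 *m gradmx lam Y V l *m (Q l)^T.
Proof.
move=> QQ QY lL; rewrite /gradmx !seg_act ?lL ?leqnn ?(ltnW lL) //.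
have YE : Y = Q L *m Y *m (Q 0)^T.
  by rewrite QY -mulmxA (mulmx1C (QQ _ (leq0n L))) mulmx1.
rewrite {1}YE -mulmxBl -mulmxBr !trmx_mul !trmxK mulmxDr mulmxDl /act.
rewrite -!scalemxAr -scalemxAl; congr (_ + _).
rewrite !mulmxA -(mulmxA _ (Q L)^T) QQ // mulmx1.
by rewrite -(mulmxA _ (Q 0)^T) QQ // mulmx1.
Qed.

End Gradient.

(** * Cayley transforms of skew-symmetric matrices *)

Section Cayley.
Variables (R : realType) (n : nat) (B : 'M[R]_n).
Hypothesis BT : B^T = - B.

Lemma skew_unitmx : 1%:M - B \in unitmx.
Proof.
rewrite -row_free_unit; apply: inj_row_free => v /eqP.
rewrite mulmxBr mulmx1 subr_eq0 => /eqP vB.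
rewrite -[v]trmxK -[RHS]trmx0; congr (_^T); apply: mulTmx_eq0; rewrite trmxK.
have e : v *m v^T = - (v *m v^T).
  have Bv : B *m v^T = - v^T by rewrite {2}vB trmx_mul BT mulNmx opprK.
  by rewrite {1}vB -mulmxA Bv mulmxN.
apply/matrixP => i j; have := congr1 (fun M : 'M[R]_1 => M i j) e; rewrite !mxE.
move: (\sum_(_ < _) _) => x; lra.
Qed.

(** An algebraic substitute for the matrix exponential: it turns skew-symmetric matrices into
    orthogonal ones. The fixed-point form below shows that its derivative at zero is twice the
    identity. *)
Definition cayley : 'M[R]_n := invmx (1%:M - B) *m (1%:M + B).

Lemma cayleyE : cayley = 1%:M + B *m (1%:M + cayley).
Proof.
have e : (1%:M - B) *m cayley = 1%:M + B by rewrite mulKVmx // skew_unitmx.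
by rewrite mulmxDr mulmx1 addrA -e mulmxBl mul1mx subrK.
Qed.

Lemma cayley_orthogonal : cayley^T *m cayley = 1%:M.
Proof.
have U := skew_unitmx.
have UT : 1%:M + B \in unitmx.
  by rewrite -unitmx_tr trmxD trmx1 BT.
have comm : (1%:M - B) *m (1%:M + B) = (1%:M + B) *m (1%:M - B).
  rewrite !(mulmxDl, mulmxDr, mul1mx, mulmx1, mulNmx, mulmxN).
  by move: (B *m B) => BB; apply/matrixP => i j; rewrite !mxE; ring.
have QT : cayley^T = (1%:M - B) *m invmx (1%:M + B).
  by rewrite /cayley trmx_mul trmx_inv trmxD trmxB trmx1 BT opprK.
apply: mulmx1C; rewrite QT /cayley -mulmxA (mulmxA (1%:M + B)) -comm.
by rewrite -(mulmxA (1%:M - B)) mulmxV // mulmx1 mulVmx.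
Qed.

End Cayley.

Lemma cayley_intertwine (R : realType) m n (A : 'M[R]_m) (B : 'M[R]_n)
    (X : 'M[R]_(m, n)) : A^T = - A -> B^T = - B -> A *m X = X *m B ->
  cayley A *m X = X *m cayley B.
Proof.
move=> AT BT e; apply: (can_inj (mulKmx (skew_unitmx AT))).
rewrite mulmxA mulKVmx ?skew_unitmx // mulmxDl mul1mx e.
rewrite mulmxA mulmxBl mul1mx e.
have -> : X - X *m B = X *m (1%:M - B) by rewrite mulmxBr mulmx1.
by rewrite -mulmxA mulKVmx ?skew_unitmx // mulmxDr mulmx1.
Qed.

(** * Limits along an ultrafilter *)

Section Limits.
Import numFieldNormedType.Exports.
Local Open Scope classical_set_scope.

(** A cluster point exists by compactness, and for an ultrafilter a cluster point is a limit. One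
    ultrafilter thus replaces repeated extraction of subsequences. *)
Lemma ultra_bounded_cvg (R : realType) (T : Type) (F : set_system T)
    (x : T -> R) (C : R) :
  UltraFilter F -> (forall n, `|x n| <= C) -> exists l : R, x @ F --> l.
Proof.
move=> FU xC; have FF : ProperFilter F := @ultra_proper _ F FU.
have FC : (x @ F) `[- C, C]%classic.
  by apply: (@filterE _ F) => n; rewrite /= in_itv /= -ler_norml.
have [l [_ lF]] := @segment_compact R (- C) C (x @ F) _ FC.
exists l => A Al; have [//|nA] := in_ultra_setVsetC (x @^-1` A) FU.
have [y [Ay nAy]] := lF (~` A) A nA Al.
by have := Ay nAy.
Qed.

Section MatrixLimits.
Variables (R : realType) (T : Type) (F : set_system T).
Context {FF : ProperFilter F}.

Lemma cvg_sumr (I : Type) (r : seq I) (P : pred I) (f : I -> T -> R)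
    (l : I -> R) :
  (forall i, P i -> f i n @[n --> F] --> l i) ->
  \sum_(i <- r | P i) f i n @[n --> F] --> \sum_(i <- r | P i) l i.
Proof.
move=> fl; elim: r => [|i r IH].
  under eq_fun do rewrite big_nil.
  by rewrite big_nil; apply: cvg_cst.
under eq_fun do rewrite big_cons.
rewrite big_cons; case: ifP => // Pi.
by apply: cvgD => //; apply: fl.
Qed.

Definition mcvg m n (X : T -> 'M[R]_(m, n)) (x : 'M[R]_(m, n)) :=
  forall i j, X k i j @[k --> F] --> x i j.

Lemma mcvg_cst m n (x : 'M[R]_(m, n)) : mcvg (fun=> x) x.
Proof. by move=> i j; apply: cvg_cst. Qed.

Lemma mcvg_unique m n (X : T -> 'M[R]_(m, n)) x y :
  mcvg X x -> mcvg X y -> x = y.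
Proof.
move=> Xx Xy; apply/matrixP => i j.
exact: (cvg_unique (@norm_hausdorff _ _) (Xx i j) (Xy i j)).
Qed.

Lemma mcvgD m n (X Y : T -> 'M[R]_(m, n)) x y :
  mcvg X x -> mcvg Y y -> mcvg (fun k => X k + Y k) (x + y).
Proof.
move=> Xx Yy i j; rewrite mxE; under eq_fun do rewrite mxE.
exact: cvgD.
Qed.

Lemma mcvgM m n p (X : T -> 'M[R]_(m, n)) (Y : T -> 'M[R]_(n, p)) x y :
  mcvg X x -> mcvg Y y -> mcvg (fun k => X k *m Y k) (x *m y).
Proof.
move=> Xx Yy i j; rewrite mxE; under eq_fun do rewrite mxE.
by apply: cvg_sumr => l _; apply: cvgM.
Qed.

Lemma mcvgT m n (X : T -> 'M[R]_(m, n)) x :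
  mcvg X x -> mcvg (fun k => (X k)^T) x^T.
Proof.
move=> Xx i j; rewrite mxE; under eq_fun do rewrite mxE.
exact: Xx.
Qed.

Lemma mcvgZ m n (a : T -> R) (X : T -> 'M[R]_(m, n)) (b : R) x :
  a @ F --> b -> mcvg X x -> mcvg (fun k => a k *: X k) (b *: x).
Proof.
move=> ab Xx i j; rewrite mxE; under eq_fun do rewrite mxE.
exact: cvgM.
Qed.

Lemma cvg_fdot m n (X Y : T -> 'M[R]_(m, n)) x y : mcvg X x -> mcvg Y y ->
  fdot (X k) (Y k) @[k --> F] --> fdot x y.
Proof.
move=> Xx Yy; apply: cvg_sumr => i _; apply: cvg_sumr => j _.
exact: cvgM.
Qed.

Variable t : T -> R.
Hypothesis t_neq0 : forall k, t k != 0.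
Hypothesis t_cvg0 : t @ F --> (0 : R).

(* [x'] is the derivative at [x] of a quantity moving from [X k] to [X' k]
   during the step [t k]. *)
Definition dcvg m n (X X' : T -> 'M[R]_(m, n)) (x x' : 'M[R]_(m, n)) :=
  mcvg X x /\ mcvg (fun k => (t k)^-1 *: (X' k - X k)) x'.

Lemma dcvg_target m n (X X' : T -> 'M[R]_(m, n)) x x' :
  dcvg X X' x x' -> mcvg X' x.
Proof.
move=> [Xx dX]; rewrite -[x]addr0 -(scale0r x').
have -> : X' = fun k => X k + t k *: ((t k)^-1 *: (X' k - X k)).
  by apply/funext => k; rewrite scalerA mulfV // scale1r addrC subrK.
by apply: mcvgD => //; apply: mcvgZ.
Qed.

Lemma dcvg_cst m n (x : 'M[R]_(m, n)) : dcvg (fun=> x) (fun=> x) x 0.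
Proof.
split; first exact: mcvg_cst.
under eq_fun do rewrite subrr scaler0.
exact: mcvg_cst.
Qed.

Lemma dcvgD m n (X X' Y Y' : T -> 'M[R]_(m, n)) x x' y y' :
  dcvg X X' x x' -> dcvg Y Y' y y' ->
  dcvg (fun k => X k + Y k) (fun k => X' k + Y' k) (x + y) (x' + y').
Proof.
move=> [Xx dX] [Yy dY]; split; first exact: mcvgD.
under eq_fun do rewrite opprD addrACA scalerDr.
exact: mcvgD.
Qed.

Lemma dcvgT m n (X X' : T -> 'M[R]_(m, n)) x x' :
  dcvg X X' x x' -> dcvg (fun k => (X k)^T) (fun k => (X' k)^T) x^T x'^T.
Proof.
move=> [Xx dX]; split; first exact: mcvgT.
under eq_fun do rewrite -trmxB -trmxZ.
exact: mcvgT.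
Qed.

Lemma dcvgZ m n (X X' : T -> 'M[R]_(m, n)) x x' a :
  dcvg X X' x x' ->
  dcvg (fun k => a *: X k) (fun k => a *: X' k) (a *: x) (a *: x').
Proof.
move=> [Xx dX]; split; first by apply: mcvgZ => //; apply: cvg_cst.
under eq_fun do rewrite -scalerBr scalerA mulrC -scalerA.
by apply: mcvgZ => //; apply: cvg_cst.
Qed.

Lemma dcvgM m n p (X X' : T -> 'M[R]_(m, n)) (Y Y' : T -> 'M[R]_(n, p))
    x x' y y' :
  dcvg X X' x x' -> dcvg Y Y' y y' ->
  dcvg (fun k => X k *m Y k) (fun k => X' k *m Y' k)
    (x *m y) (x' *m y + x *m y').
Proof.
move=> dX dY; have Y'y := dcvg_target dY.
case: dX dY => Xx dX [Yy dY]; split; first exact: mcvgM.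
have -> : (fun k => (t k)^-1 *: (X' k *m Y' k - X k *m Y k)) =
    fun k => ((t k)^-1 *: (X' k - X k)) *m Y' k
             + X k *m ((t k)^-1 *: (Y' k - Y k)).
  apply/funext => k; rewrite -scalemxAl -scalemxAr -scalerDr mulmxBl mulmxBr.
  by rewrite subrKA.
by apply: mcvgD; apply: mcvgM.
Qed.

Variable d : nat -> nat.

Lemma dcvg_seg (V W : T -> weights R d) (v u : weights R d) i j :
  (forall k, (k < j)%N -> dcvg (fun n => V n k) (fun n => W n k) (v k) (u k)) ->
  (i <= j)%N ->
  dcvg (fun n => seg (V n) i j) (fun n => seg (W n) i j)
    (seg v i j) (dseg v u i j).
Proof.
have id k (X : T -> weights R d) : (fun n => seg (X n) k k) = fun=> 1%:M.
  by apply/funext => n; rewrite segii.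
move=> dV; elim: j dV => [|j IH] dV.
  by rewrite leqn0 => /eqP ->; rewrite !id segii dsegii; apply: dcvg_cst.
rewrite leq_eqVlt => /orP[/eqP ->|].
  by rewrite !id segii dsegii; apply: dcvg_cst.
rewrite ltnS => ij; rewrite segS // dsegS //.
have step (X : T -> weights R d) :
    (fun n => seg (X n) i j.+1) = fun n => X n j *m seg (X n) i j.
  by apply/funext => n; rewrite segS.
rewrite !step; apply: dcvgM; first exact: dV.
by apply: IH => // k kj; apply/dV/ltnW.
Qed.

(** A strict form of differentiability: the base point [V n] and the end point [W n] both move, and
    the quotients still converge to the Hessian at the limit [v]. *)
Lemma dcvg_gradmx (L : nat) (lam : nat -> R) (Y : 'M[R]_(d L, d 0))
    (V W : T -> weights R d) (v u : weights R d) l :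
  (forall k, (k < L)%N -> dcvg (fun n => V n k) (fun n => W n k) (v k) (u k)) ->
  (l < L)%N ->
  dcvg (fun n => gradmx lam Y (V n) l) (fun n => gradmx lam Y (W n) l)
    (gradmx lam Y v l) (hessmx lam Y v u l).
Proof.
move=> dV lL; rewrite /gradmx /hessmx -mulmxDl.
have dl : dcvg (fun n => seg (V n) 0 l) (fun n => seg (W n) 0 l)
    (seg v 0 l) (dseg v u 0 l).
  by apply: dcvg_seg => // k kl; apply: dV; apply: ltn_trans lL.
have dE : dcvg (fun n => seg (V n) 0 L - Y) (fun n => seg (W n) 0 L - Y)
    (seg v 0 L - Y) (dseg v u 0 L).
  rewrite -[dseg _ _ _ _]addr0; apply: dcvgD; first exact: dcvg_seg.
  exact: dcvg_cst.
apply: dcvgD; last by apply/dcvgZ/dV.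
apply: dcvgM; last exact: dcvgT.
by apply: dcvgM => //; apply: dcvgT; apply: dcvg_seg.
Qed.

End MatrixLimits.

Lemma ultra_mcvg (R : realType) (T : Type) (F : set_system T) m n
    (X : T -> 'M[R]_(m, n)) (C : R) : UltraFilter F ->
  (forall k, frob2 (X k) <= C) -> exists x, mcvg F X x.
Proof.
move=> FU XC.
have H i j : exists l : R, X k i j @[k --> F] --> l.
  (* The bound [1 + C] works because a nonnegative number whose square is at most [C] is at most
     [1 + C]. *)
  apply: (@ultra_bounded_cvg _ _ _ _ (1 + C)) => k.
  have := le_trans (entry_le_frob2 (X k) i j) (XC k).
  rewrite -real_normK ?num_real //; move: (normr_ge0 (X k i j)).
  by move: `|_| => a a0 aC; nra.
exists (\matrix_(i, j) projT1 (cid (H i j))) => i j.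
by rewrite mxE; apply: (projT2 (cid (H i j))).
Qed.

(** The ratio [x / a] is bounded, hence converges; multiplying it by [a] gives limit zero. *)
Lemma ultra_squeeze (R : realType) (T : Type) (F : set_system T)
    (x a : T -> R) (C : R) : UltraFilter F ->
  (forall k, 0 < a k) -> a @ F --> (0 : R) ->
  (forall k, `|x k| <= C * a k) -> x @ F --> (0 : R).
Proof.
move=> FU a0 aF xa.
have [k|c xc] := @ultra_bounded_cvg _ _ F (fun k => x k / a k) C FU.
  by rewrite normrM normfV (gtr0_norm (a0 k)) ler_pdivrMr.
have -> : x = (fun k => x k / a k) \* a.
  by apply/funext => k /=; rewrite divfK // gt_eqF.
by rewrite -(mulr0 c); apply: cvgM.
Qed.

Lemma orthogonal_frob2 (R : realType) n (Q : 'M[R]_n) :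
  Q^T *m Q = 1%:M -> frob2 Q = n%:R.
Proof. by move=> QQ; rewrite -fdot_frob2 fdotE QQ mxtrace1. Qed.

(** * Contradiction from a sequence violating the error bound *)

Section Distance.
Variables (R : realType) (d : nat -> nat) (n : nat).
Local Notation L := n.+2.
Variables (lam : nat -> R) (Y : 'M[R]_(d L, d 0)).

Lemma wdist_sqr (W V : weights R d) :
  wdist L W V ^+ 2 = \sum_(l < L) frob2 (W l - V l).
Proof. by rewrite sqr_sqrtr // sumr_ge0 // => l _; apply: frob2_ge0. Qed.

(** Makes the infimum in [setdist] range over a nonempty set. With at least two layers, each
    gradient block at zero contains another layer as a factor. *)
Lemma critset0 : critset lam Y (fun=> 0).
Proof.
apply/critsetP => l lL; rewrite /gradmx scaler0 addr0.
case: l lL => [|l] lL.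
  by rewrite [seg _ 1 L]segS // mul0mx trmx0 !mul0mx.
by rewrite [seg _ 0 l.+1]segS // mul0mx trmx0 mulmx0.
Qed.

Lemma setdist_le (W V : weights R d) :
  critset lam Y V -> setdist L W (critset lam Y) <= wdist L W V.
Proof.
move=> cV; apply: ge_inf; last by exists V.
by exists 0 => _ [V' _ ->]; apply: sqrtr_ge0.
Qed.

Lemma setdist_approx (W : weights R d) e : 0 < e ->
  exists2 V, critset lam Y V & wdist L W V < setdist L W (critset lam Y) + e.
Proof.
move=> e0; pose S := [set r | exists2 V, critset lam Y V & r = wdist L W V].
have hS : has_inf S.
  split.
    by exists (wdist L W (fun=> 0)), (fun=> 0) => //; apply: critset0.
  by exists 0 => _ [V' _ ->]; apply: sqrtr_ge0.
have [_ [V cV ->] lt] := inf_adherent e0 hS.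
by exists V.
Qed.

Hypothesis lam_gt0 : forall l, (l < L)%N -> 0 < lam l.
Hypothesis A2_2 : L = 2 -> forall y, singular_value Y y -> 0 < y ->
  \prod_(k < L) lam k != y ^+ 2.
Hypothesis A2_3 : (3 <= L)%N -> forall y, singular_value Y y -> 0 < y ->
  \prod_(k < L) lam k != y ^+ (2 * L.-1) /
    ((((L%:R - 2) / L%:R) `^ (L%:R / (2 * L.-1%:R))
      + (L%:R / (L%:R - 2)) `^ ((L%:R - 2) / (2 * L.-1%:R))) ^+ (2 * L.-1)).

Variables W V : nat -> weights R d.
Let r k := wdist L (W k) (V k).
Let theta k : R := k.+1%:R^-1.
Hypothesis critV : forall k, critset lam Y (V k).
Hypothesis r_gt0 : forall k, 0 < r k.
Hypothesis r_le : forall k, r k <= 2 * theta k.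
Hypothesis V_near : forall k V', critset lam Y V' ->
  r k ^+ 2 * (1 - 2 * theta k ^+ 2) <= wdist L (W k) V' ^+ 2.
Hypothesis grad_small : forall k l, (l < L)%N ->
  frob2 (gradmx lam Y (W k) l) <= (theta k * r k) ^+ 2.

Let theta_gt0 k : 0 < theta k. Proof. by rewrite invr_gt0 ltr0n. Qed.

Lemma no_bad_sequence : False.
Proof.
have [F [FU sF]] := @ultraFilterLemma _ _ (@eventually_filter).
have FF : ProperFilter F := @ultra_proper _ F FU.
have th0 : theta @ F --> (0 : R) by move=> A /(@cvg_harmonic R) hA; apply: sF.
have r0 : r @ F --> (0 : R).
  apply: (ultra_squeeze (C := 2) FU theta_gt0 th0) => k.
  by rewrite gtr0_norm.
have r_neq0 k : r k != 0 by rewrite gt_eqF.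
pose U k : weights R d := fun l => (r k)^-1 *: (W k l - V k l).
have U1 k : \sum_(l < L) frob2 (U k l) = 1.
  rewrite (eq_bigr (fun l : 'I_L => (r k)^-1 ^+ 2 * frob2 (W k l - V k l))).
    by rewrite -mulr_sumr -wdist_sqr -exprMn mulVf // expr1n.
  by move=> l _; rewrite frob2Z.
have critVl k l : (l < L)%N -> gradmx lam Y (V k) l = 0.
  by move: l; apply/critsetP.
have Hv l : exists x, (l < L)%N -> mcvg F (fun k => V k l) x.
  have [lL|_] := ltnP l L; last by exists 0.
  have [k|x Vx] := ultra_mcvg (X := fun k => V k l)
    (C := frob2 Y / 4 / lam l) FU.
    rewrite ler_pdivlMr ?lam_gt0 // mulrC.
    by apply: crit_bound => //; apply: critVl.
  by exists x.
have Hu l : exists x, (l < L)%N -> mcvg F (fun k => U k l) x.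
  have [lL|_] := ltnP l L; last by exists 0.
  have [k|x Ux] := @ultra_mcvg _ _ F _ _ (fun k => U k l) 1 FU.
    rewrite -(U1 k) (bigD1 (Ordinal lL)) //= lerDl sumr_ge0 // => i _.
    exact: frob2_ge0.
  by exists x.
pose v : weights R d := fun l => projT1 (cid (Hv l)).
pose u : weights R d := fun l => projT1 (cid (Hu l)).
have Vv l (lL : (l < L)%N) : mcvg F (fun k => V k l) (v l)
  := projT2 (cid (Hv l)) lL.
have Uu l (lL : (l < L)%N) : mcvg F (fun k => U k l) (u l)
  := projT2 (cid (Hu l)) lL.
have dW l : (l < L)%N -> dcvg F r (fun k => V k l) (fun k => W k l) (v l) (u l).
  by move=> lL; split; [apply: Vv | apply: Uu].
have dG l lL := dcvg_gradmx (FF := FF) r_neq0 r0 lam Y dW (l := l) lL.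
have critv l : (l < L)%N -> gradmx lam Y v l = 0.
  move=> lL; have [Gv _] := dG l lL; apply: (mcvg_unique Gv).
  under eq_fun do rewrite critVl //.
  exact: mcvg_cst.
(* The gradient at [W k] divided by [r k] is bounded by [theta k], while the gradient at [V k] is
   zero; hence the Hessian at [v] kills [u]. *)
have hessu l : (l < L)%N -> hessmx lam Y v u l = 0.
  move=> lL; have [_ Gh] := dG l lL; apply: (mcvg_unique Gh) => i j.
  rewrite mxE.
  under eq_fun do rewrite critVl // subr0 mxE.
  apply: (@ultra_squeeze _ _ _ _ theta 1) => // k.
  rewrite mul1r normrM normfV (gtr0_norm (r_gt0 k)) mulrC ler_pdivrMr //.
  have tr0 : 0 <= theta k * r k by rewrite mulr_ge0 // ltW.
  rewrite -ler_sqr ?nnegrE // real_normK ?num_real //.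
  exact: le_trans (entry_le_frob2 _ i j) (grad_small k lL).
have [A [AT AY Au]] := kernel_gauge_scaled lam_gt0 A2_2 A2_3 critv hessu.
(* Choice of step: the first-order gain in squared distance is of order [theta k * r k ^+ 2], which
   dominates both the quadratic term of the step and the slack in [V_near], each of order
   [theta k ^+ 2 * r k ^+ 2]. *)
pose s k := theta k * r k.
have s_neq0 k : s k != 0 by rewrite mulf_neq0 // gt_eqF.
have s0 : s @ F --> (0 : R) by rewrite -(mulr0 0); apply: cvgM.
pose Q k l := cayley (s k *: A l).
have sAT k l : (l <= L)%N -> (s k *: A l)^T = - (s k *: A l).
  by move=> lL; rewrite trmxZ AT // scalerN.
have QQ k l : (l <= L)%N -> (Q k l)^T *m Q k l = 1%:M.
  by move=> lL; apply/cayley_orthogonal/sAT.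
have dQ l : (l <= L)%N ->
    dcvg F s (fun=> 1%:M) (fun k => Q k l) 1%:M (2 *: A l).
  move=> lL; split; first exact: mcvg_cst.
  (* Orthogonal matrices are bounded, so [Q k l] converges; the fixed-point form of the Cayley
     transform identifies the limit as the identity, and then gives the quotient the limit
     [2 *: A l]. *)
  have [k|q Qq] := @ultra_mcvg _ _ F _ _ (fun k => Q k l) (d l)%:R FU.
    by rewrite orthogonal_frob2 ?QQ.
  have q1 : q = 1%:M.
    apply: (mcvg_unique Qq); rewrite -[X in mcvg _ _ X]addr0.
    rewrite -(scale0r (A l *m (1%:M + q))).
    have -> : (fun k => Q k l) = fun k => 1%:M + s k *: (A l *m (1%:M + Q k l)).
      by apply/funext => k; rewrite {1}/Q cayleyE ?sAT // -scalemxAl.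
    apply: mcvgD; first exact: mcvg_cst.
    apply: mcvgZ => //; apply: mcvgM; first exact: mcvg_cst.
    by apply: mcvgD => //; apply: mcvg_cst.
  have -> : 2 *: A l = A l *m (1%:M + q).
    by rewrite q1 mulmxDr mulmx1 scaler_nat mulr2n.
  have -> : (fun k => (s k)^-1 *: (Q k l - 1%:M)) =
      fun k => A l *m (1%:M + Q k l).
    apply/funext => k; rewrite {1}/Q cayleyE ?sAT // addrC addKr -scalemxAl.
    by rewrite scalerA mulVf // scale1r.
  apply: mcvgM; first exact: mcvg_cst.
  by apply: mcvgD => //; apply: mcvg_cst.
pose V' k := act (Q k) (V k).
have critV' k : critset lam Y (V' k).
  apply/critsetP => l lL; rewrite gradmx_act ?critVl // ?mulmx0 ?mul0mx //.
    by move=> i; apply: QQ.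
  by apply: cayley_intertwine; rewrite ?sAT // -scalemxAl AY scalemxAr.
pose Z k l := (s k)^-1 *: (V' k l - V k l).
(* Differentiating both orthogonal factors of [V'] gives [2 *: rotate A v l], which is
   [2 *: u l]. *)
have Zu l : (l < L)%N -> mcvg F (fun k => Z k l) (2 *: u l).
  move=> lL.
  have dV : dcvg F s (fun k => V k l) (fun k => V k l) (v l) 0.
    split; first exact: Vv.
    under eq_fun do rewrite subrr scaler0.
    exact: mcvg_cst.
  have [_] := dcvgM (FF := FF) s_neq0 s0 (dcvgM s_neq0 s0 (dQ _ lL) dV)
    (dcvgT (dQ _ (ltnW lL))).
  rewrite trmx1 !mul1mx !mulmx1 addr0 trmxZ AT ?(ltnW lL) // scalerN mulmxN.
  rewrite -scalemxAl -scalemxAr -scalerBr -[_ - _]/(rotate A v l) Au //.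
  by under eq_fun do rewrite mul1mx mulmx1.
(* The inequality [V_near] for [V'], expanded and divided by [theta k * r k ^+ 2], says [0 <= g k];
   yet [g] tends to [-4], since [u] is a unit vector and [Z] tends to [2 u]. *)
pose g k := - 2 * (\sum_(l < L) fdot (U k l) (Z k l))
  + theta k * (\sum_(l < L) fdot (Z k l) (Z k l) + 2).
have g_ge0 k : 0 <= g k.
  have := V_near k (critV' k); rewrite wdist_sqr.
  have -> : \sum_(l < L) frob2 (W k l - V' k l) = \sum_(l < L) r k ^+ 2 *
      (frob2 (U k l) + 2 * fdot (U k l) (Z k l) * - theta k
       + fdot (Z k l) (Z k l) * (- theta k) ^+ 2).
    apply: eq_bigr => l _; rewrite fdot_frob2 -frob2D -frob2Z; congr frob2.
    have rU : r k *: U k l = W k l - V k l by rewrite scalerA mulfV // scale1r.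
    have sZ : (r k * theta k) *: Z k l = V' k l - V k l.
      have -> : r k * theta k = s k by rewrite mulrC.
      by rewrite scalerA (mulfV (s_neq0 k)) scale1r.
    by rewrite scalerDr rU scaleNr scalerN scalerA sZ opprB addrA subrK.
  rewrite -mulr_sumr ler_pM2l ?exprn_gt0 // !big_split /= U1.
  rewrite -!mulr_suml -mulr_sumr.
  rewrite /g; move: (theta_gt0 k).
  move: (\sum_(l < L) fdot _ _) (\sum_(l < L) fdot _ _).
  move: (theta k) => th x y th_gt0 ineq.
  by rewrite -(pmulr_rge0 _ th_gt0); lra.
have g_lim : g @ F --> - 2 * (\sum_(l < L) fdot (u l) (2 *: u l))
    + 0 * (\sum_(l < L) fdot (2 *: u l) (2 *: u l) + 2).
  apply: cvgD.
    apply: cvgM; first exact: cvg_cst.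
    by apply: cvg_sumr => l _; apply: cvg_fdot; [apply: Uu | apply: Zu].
  apply: cvgM => //; apply: cvgD; last exact: cvg_cst.
  by apply: cvg_sumr => l _; apply: cvg_fdot; apply: Zu.
have u1 : \sum_(l < L) fdot (u l) (u l) = 1.
  have cu : \sum_(l < L) fdot (U k l) (U k l) @[k --> F]
      --> \sum_(l < L) fdot (u l) (u l).
    by apply: cvg_sumr => l _; apply: cvg_fdot; apply: Uu.
  apply: (cvg_unique (@norm_hausdorff _ _) cu).
  have -> : (fun k => \sum_(l < L) fdot (U k l) (U k l)) = fun=> 1.
    apply/funext => k; rewrite -(U1 k).
    by apply: eq_bigr => l _; rewrite fdot_frob2.
  exact: cvg_cst.
have u2 : \sum_(l < L) fdot (u l) (2 *: u l) = 2.
  rewrite -[RHS]mulr1 -u1 mulr_sumr; apply: eq_bigr => l _.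
  rewrite /fdot mulr_sumr; apply: eq_bigr => i _; rewrite mulr_sumr.
  by apply: eq_bigr => j _; rewrite mxE mulrCA.
have : 0 <= lim (g @ F).
  by apply: limr_ge; [apply: cvgP g_lim | apply: filterE].
rewrite (cvg_lim (@norm_hausdorff _ _) g_lim) u2 mul0r addr0.
by rewrite leNgt => /negP; apply; lra.
Qed.

End Distance.

End Limits.

(** * Extraction of a violating sequence *)

Theorem theorem2p2 (R : realType) (L : nat) (d : nat -> nat)
  (lam : nat -> R) (Y : 'M[R]_(d L, d 0)) :
  (2 <= L)%N ->
  (forall l, (l <= L)%N -> (0 < d l)%N) ->
  (forall l, (l < L)%N -> 0 < lam l) ->
  (* (A1) *)
  (forall l, (0 < l)%N -> (l < L)%N -> (minn (d 0) (d L) <= d l)%N) ->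
  (* (A2) *)
  (L = 2%N -> forall y, singular_value Y y -> 0 < y ->
     \prod_(k < L) lam k != y ^+ 2) ->
  ((3 <= L)%N -> forall y, singular_value Y y -> 0 < y ->
     \prod_(k < L) lam k !=
       y ^+ (2 * L.-1) /
       ((((L%:R - 2) / L%:R) `^ (L%:R / (2 * L.-1%:R))
         + (L%:R / (L%:R - 2)) `^ ((L%:R - 2) / (2 * L.-1%:R))) ^+ (2 * L.-1))) ->
  exists eps1 : R, exists kappa1 : R, 0 < eps1 /\ 0 < kappa1 /\
    forall W : weights R d,
      setdist L W (critset lam Y) <= eps1 ->
      setdist L W (critset lam Y) <= kappa1 * Num.sqrt (gradnorm2 lam Y W).
Proof.
case: L Y => [//|[//|n]] Y _ _ lam_gt0 _ A2_2 A2_3; set L := n.+2.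
pose crit := critset lam Y; pose dist W := setdist L W crit.
apply: contrapT => noeps.
(* Negate the conclusion for radius [1 / (k + 1)] and constant [k + 1]. *)
have bad k : exists W : weights R d, dist W <= k.+1%:R^-1 /\
    k.+1%:R * Num.sqrt (gradnorm2 lam Y W) < dist W.
  apply: contrapT => H; apply: noeps; exists k.+1%:R^-1, k.+1%:R.
  rewrite invr_gt0 !ltr0n; split=> //; split=> // W dW.
  by rewrite leNgt; apply/negP => lt; apply: H; exists W.
have {noeps} [W badW] := choice bad.
pose theta k : R := k.+1%:R^-1.
have th0 k : 0 < theta k by rewrite invr_gt0 ltr0n.
have th1 k : theta k <= 1 by rewrite invf_le1 ?ltr0n // ler1n.
have dist_gt0 k : 0 < dist (W k).
  by apply: le_lt_trans (badW k).2; rewrite mulr_ge0 // sqrtr_ge0.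
(* An approximate nearest point suffices; the relative error [theta k ^+ 2] is chosen to be of
   smaller order than the gain [theta k] obtained by moving along the symmetry. *)
have near k : exists V, crit V /\
    wdist L (W k) V < dist (W k) * (1 + theta k ^+ 2).
  have e0 : 0 < dist (W k) * theta k ^+ 2 by rewrite mulr_gt0 ?exprn_gt0.
  have [V cV lt] := @setdist_approx _ _ _ lam Y (W k) _ e0.
  by exists V; rewrite mulrDr mulr1.
have {near} [V nearV] := choice near.
have critV k : critset lam Y (V k) := (nearV k).1.
have dist_r k : dist (W k) <= wdist L (W k) (V k) by apply: setdist_le.
apply: (@no_bad_sequence R d n lam Y lam_gt0 A2_2 A2_3 W V critV).
- by move=> k; apply: lt_le_trans (dist_gt0 k) (dist_r k).
- move=> k; apply: le_trans (ltW (nearV k).2) _; rewrite mulrC.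
  have le2 : 1 + theta k ^+ 2 <= 2 by have := th0 k; have := th1 k; nra.
  apply: ler_pM => //; last exact: (badW k).1; last exact: ltW.
  by rewrite addr_ge0 ?exprn_ge0 ?ltW.
- move=> k V' cV'; rewrite -/(theta k); have := setdist_le (W k) cV'.
  rewrite -/(dist _) => le'.
  apply: (@le_trans _ _ (dist (W k) ^+ 2)); last first.
    by rewrite ler_sqr ?nnegrE ?sqrtr_ge0 // ltW.
  have := (nearV k).2; have := dist_r k; have := dist_gt0 k.
  have : 0 <= theta k ^+ 2 by rewrite exprn_ge0 ?ltW.
  move: (dist _) (wdist _ _ _) (theta k ^+ 2) => a b q q0 a0 ab bq.
  have [q2|q2] := lerP (1 - 2 * q) 0.
    by apply: (@le_trans _ _ 0); rewrite ?sqr_ge0 // mulr_ge0_le0 ?sqr_ge0.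
  (* With [q = theta k ^+ 2], the bound follows from [(1 + q) ^+ 2 * (1 - 2 * q) <= 1]. *)
  apply: (@le_trans _ _ ((a * (1 + q)) ^+ 2 * (1 - 2 * q))).
    rewrite ler_pM2r // ler_sqr ?nnegrE ?(ltW bq) //.
      by rewrite (le_trans _ ab) // ltW.
    by apply: mulr_ge0; [exact: ltW | rewrite addr_ge0].
  rewrite exprMn -mulrA ler_piMr ?sqr_ge0 //.
  have q3 : 0 <= q ^+ 3 by rewrite exprn_ge0.
  have q4 : 0 <= q ^+ 2 by rewrite exprn_ge0.
  have -> : (1 + q) ^+ 2 * (1 - 2 * q) = 1 - 3 * q ^+ 2 - 2 * q ^+ 3 by ring.
  by lra.
- move=> k l lL; rewrite -/(theta k).
  have g_ge0 : 0 <= gradnorm2 lam Y (W k).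
    by rewrite gradnorm2E sumr_ge0 // => i _; rewrite mulr_ge0 // frob2_ge0.
  have le1 : frob2 (gradmx lam Y (W k) l) <= gradnorm2 lam Y (W k).
    rewrite gradnorm2E (bigD1 (Ordinal lL)) //=.
    have := frob2_ge0 (gradmx lam Y (W k) l).
    have : 0 <= \sum_(i < L | i != Ordinal lL) 4 * frob2 (gradmx lam Y (W k) i).
      by rewrite sumr_ge0 // => i _; rewrite mulr_ge0 // frob2_ge0.
    by lra.
  apply: le_trans le1 _; rewrite -(sqr_sqrtr g_ge0).
  rewrite ler_sqr ?nnegrE ?sqrtr_ge0 //.
    rewrite mulrC ler_pdivlMr ?ltr0n // mulrC.
    exact: le_trans (ltW (badW k).2) (dist_r k).
  by rewrite mulr_ge0 ?ltW // (lt_le_trans (dist_gt0 k)).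
Qed.
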